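(* Fix $T>0$, $0\leq t<T$, $\tau=T-t$, $r\geq 0$, $\sigma>0$, and $S_t\geq M_t>0$. For $n\in\mathbb{N}$ let $C^{fl}_n(t)$ be the $n$-period binomial price of the European lookback call with floating strike at time $t$ (defined in the context). Then, as $n\to\infty$: (i) if $r>0$, \[ \begin{split} C_{n}^{fl}(t)&=C^{fl}_{BS}(t)-S_t\frac{\sigma\sqrt{\tau}}{2}\big(\theta_1 B_1+\theta_2 B_3\big)\frac{1}{\sqrt{n}}\\ &\quad-\Big[S_t\frac{\sigma^2 \tau}{12}\Big((\theta_1+2)B_1+(\theta_2+2-T_1)B_3\Big)-M_t T_2 B_4\Big]\frac{1}{n}+O\Bigl(\frac{1}{n^{3/2}}\Bigr), \end{split} \] where $C^{fl}_{BS}(t)=S_t-S_t \theta_1 B_1-M_t B_2+S_t(1-\theta_2)B_3$, $\theta_1=1+\frac{\sigma^2}{2r}$, $\theta_2=1-\frac{\sigma^2}{2r}$, $B_1=\Phi(-d_1)$, $B_2=e^{-r\tau}\Phi(d_2)$, $B_3=e^{-r\tau}\big(\frac{S_t}{M_t}\big)^{-2r/\sigma^2}\Phi(d_3)$, $B_4=\sigma\sqrt{\tau}\big(\frac{S_t}{M_t}\big)^{(1-2r/\sigma^2)/2}\frac{e^{-\frac{1}{4}(d_1^2+d_4^2)}}{\sqrt{2\pi}}$, $T_1=\frac{12r}{\sigma^2}\theta_2\kappa_n-(1+\frac{4r^2}{\sigma^4})\log\frac{S_t}{M_t}$ and $T_2=\frac{1}{2}+\kappa_n+\frac{d_4}{6\sigma\sqrt{\tau}}\log\frac{S_t}{M_t}$;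 (ii) if $r=0$, \[ \begin{split} C_{n}^{fl}(t)&=C^{fl}_{BS}(t)-S_t\frac{\sigma\sqrt{\tau}}{2}\big(2B_1+B_3^*-B_4^*\big)\frac{1}{\sqrt{n}}\\ &\quad-\Big[S_t\frac{\sigma^2 \tau}{6}\Big(\big( 3+3\kappa_n-\frac{\sigma^2 \tau}{4}\big)B_1+B_3^*\Big)-S_t T_2^* B_4^*\Big]\frac{1}{n}+O\Bigl(\frac{1}{n^{3/2}}\Bigr), \end{split} \] where $C^{fl}_{BS}(t)=S_t-S_t B_1-M_t B_2-S_t(B_3^*-B_4^* )$, $B_1=\Phi(-d_1)$, $B_2=e^{-r\tau}\Phi(d_2)$ (so $B_2=\Phi(d_2)$), $B_3^*=\big(\log\frac{S_t}{M_t}+\frac{\sigma^2\tau}{2}\big)\Phi(-d_1)$, $B_4^*=\sigma\sqrt{\tau}\frac{e^{-d_1^2/2}}{\sqrt{2\pi}}$ and $T_2^*=\frac{1}{2}+\kappa_n+\frac{\sigma^2 \tau}{12}-\frac{d_2}{6\sigma\sqrt{\tau}}\log\frac{S_t}{M_t}$.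
   Context: $S_t$ is the price of the underlying at time $t$ and $M_t=\min_{t^*\leq t}S_{t^*}$ its running minimum. Binomial model: $u=e^{\sigma\sqrt{\tau/n}}$, $d=u^{-1}$, $p=\frac{e^{r\tau/n}-d}{u-d}$ (with $n$ large enough that $0<p<1$), $q=\frac{u-e^{-r\tau/n}}{u-d}$, and $j_0=\frac{\log(S_t/M_t)}{\sigma\sqrt{\tau/n}}$. Consider the directed graph with initial node $(0,j_0)$ in which, from each node $(m,j_m)$ with $0\leq m<n$, there is an ''up'' edge to $(m+1,j_m+1)$ and a ''down'' edge to $(m+1,\max(j_m-1,0))$; let $\Lambda^{j_0}_{j,k,n}$ be the number of paths from $(0,j_0)$ to $(n,j)$ with exactly $k$ up jumps, and $J$ the set of reachable terminal levels $j$. The discrete price is $C^{fl}_n(t) = S_t \sum_{j\in J} (1-u^{-j})\sum_{k=0}^n \Lambda^{j_0}_{j,k,n} q^k(1-q)^{n-k}$. Further, $\kappa_n=\{j_0\}(1-\{j_0\})$ where $\{x\}=x-\lfloor x\rfloor$ is the fractional part, $\Phi$ is the standard normal distribution function, and $d_1=\frac{1}{\sigma\sqrt{\tau}}\big(\log\frac{S_t}{M_t}+(r+\frac{\sigma^2}{2})\tau\big)$, $d_2=d_1-\sigma\sqrt{\tau}$, $d_3=-d_1+\frac{2r}{\sigma}\sqrt{\tau}$, $d_4=d_3+\sigma\sqrt{\tau}$. *)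

(* Defs.v *)
From HB Require Import structures.
From mathcomp Require Import all_boot all_order all_algebra.
From mathcomp Require Import all_classical all_reals all_analysis.
Set Implicit Arguments. Unset Strict Implicit. Unset Printing Implicit Defensive.
Import Order.TTheory GRing.Theory Num.Theory.
Local Open Scope ring_scope.

Section Defs.
Variable R : realType.

Definition Phi (x : R) : R := fine (normal_prob (0:R) 1 `]-oo, x]%classic).

Definition level (j0 : R) (w : seq bool) : R :=
  foldl (fun j (b : bool) => if b then j + 1 else Num.max (j - 1) 0) j0 w.

Definition Lambda (j0 j : R) (k n : nat) : nat :=
  #|[set w : n.-tuple bool | (level j0 w == j) && (count id w == k)]|.

Definition Jset (j0 : R) (n : nat) : seq R :=
  undup [seq level j0 (tval w) | w <- enum {: n.-tuple bool}].

Definition u_ (sigma tau : R) (n : nat) : R := expR (sigma * Num.sqrt (tau / n%:R)).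
Definition q_ (r sigma tau : R) (n : nat) : R :=
  let u := u_ sigma tau n in
  (u - expR (- (r * tau / n%:R))) / (u - u^-1).
Definition j0_ (sigma tau S M : R) (n : nat) : R :=
  ln (S / M) / (sigma * Num.sqrt (tau / n%:R)).

Definition Cfl_n (r sigma tau S M : R) (n : nat) : R :=
  let u := u_ sigma tau n in
  let q := q_ r sigma tau n in
  let j0 := j0_ sigma tau S M n in
  S * \sum_(j <- Jset j0 n) (1 - u `^ (- j)) *
      \sum_(0 <= k < n.+1) (Lambda j0 j k n)%:R * q ^+ k * (1 - q) ^+ (n - k).

Definition frac (x : R) : R := x - (Num.floor x)%:~R.
Definition kappa_ (sigma tau S M : R) (n : nat) : R :=
  let j0 := j0_ sigma tau S M n in frac j0 * (1 - frac j0).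

Definition d1_ (r sigma tau S M : R) : R :=
  (ln (S / M) + (r + sigma ^+ 2 / 2) * tau) / (sigma * Num.sqrt tau).
Definition d2_ (r sigma tau S M : R) : R := d1_ r sigma tau S M - sigma * Num.sqrt tau.
Definition d3_ (r sigma tau S M : R) : R :=
  - d1_ r sigma tau S M + 2 * r / sigma * Num.sqrt tau.
Definition d4_ (r sigma tau S M : R) : R := d3_ r sigma tau S M + sigma * Num.sqrt tau.

End Defs.

(* Main.v *)
(* The weights q^k (1-q)^(n-k) make C_n / S = 1 - E[u^-J], where J is the final
   position of a random walk reflected at 0.  A reflection argument writes
   E[u^-J] as a combination of four binomial tails, two under p and two under
   1-q.

   As a function of the drift a of the walk, a tail has derivative
   const (1+a)^(b-1) (1-a)^(n-b).  With a = s / sqrt n this is, for s in a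
   slowly growing window, const exp(-s^2/2 + z s) (1 + poly(s,z)/n + ...), and
   beyond the window Chernoff bounds apply.  Comparing the total mass 1 of both
   sides identifies the constant (so Stirling's formula is not needed) and
   yields the Edgeworth expansion of the tails up to O(n^(-3/2)).

   It remains to expand the coefficients of the tails in powers of
   1 / sqrt n.  The parity of n - floor j0 enters every tail but cancels in the
   sum, whereas the fractional part of j0 survives as kappa_n.  When r = 0 two
   geometric sums degenerate, and the derivative of a tail appears as well. *)

Require Import Defs.
From HB Require Import structures.
From mathcomp Require Import all_boot all_order all_algebra.
From mathcomp Require Import all_classical all_reals all_analysis.
From mathcomp Require Import ring lra zify.
Import Order.TTheory GRing.Theory Num.Theory.
Import numFieldNormedType.Exports.
Local Open Scope classical_set_scope.
Local Open Scope ring_scope.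
Set Implicit Arguments.
Unset Strict Implicit.
Unset Printing Implicit Defensive.

(** A binomial tail jumps as a function of its threshold, but it is a polynomial in the success
    probability. Differentiating in the drift therefore avoids any sum over the lattice, and with it
    any continuity correction: a single monomial remains, whose logarithm can be expanded, and the
    integer threshold survives only inside the scaled parameter [z]. No integral is expanded either;
    a uniform bound on the density error and the mean value theorem over the window suffice. The
    obstacle is that the fractional part of [j0] and the parity of the threshold oscillate with [n],
    so that beyond the leading order the coefficients have no limit in general. Expansions hence
    carry bounded sequences as coefficients. Their algebra stays tractable because the normal
    densities at [d2], [d3] and [-d1], once multiplied by their weights, are one and the same
    number. The reflection argument is not carried out on paths. The closed form is checked against
    the one-step recursion of the walk, and the floor at 0 becomes a boundary identity at level
    -1. *)

Section Calculus.
Variable R : realType.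
Implicit Types f df : R -> R.

Lemma is_derive_cc f (df : R -> R) (a b : R) :
  (forall x, x \in `[a, b] -> is_derive x (1:R) f (df x)) ->
  {within `[a, b], continuous f}%classic.
Proof.
move=> fd; apply: derivable_within_continuous => x xab.
by have := fd x xab; case.
Qed.

Lemma mean_value f df (a b : R) : a <= b ->
  (forall x, x \in `[a, b] -> is_derive x (1:R) f (df x)) ->
  exists2 c, c \in `[a, b] & f b - f a = df c * (b - a).
Proof.
move=> ab fd; have fc := is_derive_cc fd.
have fo x : x \in `]a, b[ -> is_derive x (1:R) f (df x).
  by move=> xab; exact: (fd _ (subset_itv_oo_cc xab)).
exact: (@MVT_segment R f df a b ab fo fc).
Qed.

Lemma mean_value_le f df (K x y : R) :
  (forall z, (x <= z <= y) || (y <= z <= x) -> is_derive z (1:R) f (df z)) ->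
  (forall z, (x <= z <= y) || (y <= z <= x) -> `|df z| <= K) ->
  `|f y - f x| <= K * `|y - x|.
Proof.
wlog xy : x y / x <= y => [H|] fd fK.
  have [/H|/ltW/H] := leP x y; first exact.
  rewrite distrC [X in K * X]distrC; apply => z; rewrite orbC; [exact: fd|exact: fK].
have [|c cab ->] := @mean_value f df x y xy.
  by move=> z; rewrite in_itv/= => zz; apply: fd; rewrite zz.
rewrite normrM ler_wpM2r// fK//; by move: cab; rewrite in_itv/= => ->.
Qed.

Lemma derive_ge0_le f df (x y : R) : x <= y ->
  (forall z, x <= z <= y -> is_derive z (1:R) f (df z)) ->
  (forall z, x <= z <= y -> 0 <= df z) -> f x <= f y.
Proof.
move=> xy fd fK.
have fd' z : z \in `[x, y] -> is_derive z (1:R) f (df z).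
  by rewrite in_itv/= => zz; apply: fd.
have [c cab H] := mean_value xy fd'.
rewrite -subr_ge0 H; apply: mulr_ge0; last by rewrite subr_ge0.
by apply: fK; move: cab; rewrite in_itv.
Qed.

End Calculus.

(** * The standard normal distribution *)

Section Normal.
Variable R : realType.

Definition phi (x : R) : R := expR (- x ^+ 2 / 2) / Num.sqrt (2 * pi).

Lemma sqrt2pi_gt0 : 0 < Num.sqrt (2 * pi : R).
Proof. by rewrite sqrtr_gt0 mulr_gt0 ?pi_gt0. Qed.

Lemma phi_gt0 x : 0 < phi x.
Proof. by rewrite divr_gt0 ?expR_gt0 ?sqrt2pi_gt0. Qed.

Lemma phi_ge0 x : 0 <= phi x. Proof. exact/ltW/phi_gt0. Qed.

Lemma normal_pdf01 : normal_pdf (0:R) 1 = phi.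
Proof.
apply/funext => x; rewrite normal_pdfE ?oner_neq0// /normal_peak /normal_fun /phi.
by rewrite mulrC expr1n subr0 mul1r -[pi *+ 2]mulr_natl.
Qed.

Lemma is_derive_phi (x : R) : is_derive x (1:R) phi (- x * phi x).
Proof.
rewrite /phi; apply: is_derive_eq.
rewrite /GRing.scale/=; field.
by rewrite gt_eqF ?sqrt2pi_gt0.
Qed.

Lemma PhiE (x : R) : Phi x = Rintegral lebesgue_measure `]-oo, x] phi.
Proof. by rewrite /Phi /normal_prob normal_pdf01. Qed.

Lemma is_derive_Phi (x : R) : is_derive x (1:R) (@Phi R) (phi x).
Proof.
have -> : @Phi R = fun x => Rintegral lebesgue_measure `]-oo, x] phi.
  by apply/funext => y; rewrite PhiE.
have [||||dP dPE] := @continuous_FTC1 R phi -oo%O x (x + 1).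
- by rewrite ltrDl.
- have := @integrable_normal_pdf R 0 1; rewrite normal_pdf01 => ip.
  exact: (integrableS measurableT _ _ ip).
- by rewrite ltNyr.
- by rewrite -normal_pdf01; apply: continuous_normal_pdf; exact: oner_neq0.
by split; [exact: dP|rewrite -dPE derive1E].
Qed.

Let idTR : measurableTypeR R -> R := idfun.

#[local] HB.instance Definition _ :=
  @isMeasurableFun.Build _ _ _ _ idTR (@measurable_id _ _ setT).

Let Phi_cdf (x : R) : Phi x = fine (cdf (idTR : {RV (@normal_prob R 0 1) >-> R}) x).
Proof. by []. Qed.

Lemma cvg_Phi_Ny : (@Phi R x @[x --> -oo] --> (0:R))%classic.
Proof.
under eq_fun do rewrite Phi_cdf.
exact/fine_cvg/cvg_cdfNy0.
Qed.

Lemma cvg_Phi_y : (@Phi R x @[x --> +oo] --> (1:R))%classic.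
Proof.
under eq_fun do rewrite Phi_cdf.
exact/fine_cvg/cvg_cdfy1.
Qed.

(** Both [1 + x] and [1 - x] dominate [-x^2/2]. This decay is far from sharp, but it is used only at
    distance about [1/w], where [exp(-1/w)] is smaller than every power of [w]. *)
Lemma phi_le_expR (s : bool) (x : R) :
  phi x <= expR 1 / Num.sqrt (2 * pi) * expR ((-1) ^+ s * x).
Proof.
rewrite mulrAC ler_wpM2r ?invr_ge0 ?sqrtr_ge0// -expRD ler_expR.
by case: s; rewrite ?expr1 ?expr0; nra.
Qed.

Let K : R := expR 1 / Num.sqrt (2 * pi).

Let K_ge0 : 0 <= K.
Proof. by rewrite divr_ge0 ?expR_ge0 ?sqrtr_ge0. Qed.

(** [K * expR z - Phi z] is nondecreasing because [phi] is below [K * expR]. A point [y] far to the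
    left, where [Phi y <= e], stands in for the limit at minus infinity. *)
Lemma Phi_le_expR : exists C : R, forall x : R, Phi x <= C * expR x.
Proof.
exists K => x; apply/ler_addgt0Pr => e e0.
have [y yx Py] : exists2 y, y <= x & Phi y <= e.
  have /cvgrPdist_le /(_ e e0) [M [_ HM]] := cvg_Phi_Ny.
  exists (Num.min x (M - 1)); first by rewrite ge_min lexx.
  have := HM (Num.min x (M - 1)); rewrite sub0r normrN => H.
  by apply: le_trans (ler_norm _) (H _); rewrite gt_min ltrBlDr ltrDl ltr01 orbT.
pose g z : R := K * expR z - Phi z.
suff : g y <= g x by rewrite /g; have := expR_gt0 y; have := K_ge0; nra.
apply: (derive_ge0_le yx (df := fun z => K * expR z - phi z)) => z _.
  have ? := is_derive_Phi z.
  by apply: is_derive_eq; rewrite /GRing.scale/=; lra.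
by rewrite subr_ge0; have := phi_le_expR false z; rewrite expr0 mul1r.
Qed.

Lemma Phi_ge_expR : exists C : R, forall x : R, 1 - Phi x <= C * expR (- x).
Proof.
exists K => x; apply/ler_addgt0Pr => e e0.
have [y yx Py] : exists2 y, x <= y & 1 - Phi y <= e.
  have /cvgrPdist_le /(_ e e0) [M [_ HM]] := cvg_Phi_y.
  exists (Num.max x (M + 1)); first by rewrite le_max lexx.
  apply: le_trans (ler_norm _) (HM _ _).
  by rewrite lt_max ltrDl ltr01 orbT.
pose g z : R := - (K * expR (- z)) - Phi z.
suff : g x <= g y by rewrite /g; have := expR_gt0 (- y); have := K_ge0; nra.
apply: (derive_ge0_le yx (df := fun z => K * expR (- z) - phi z)) => z _.
  have ? := is_derive_Phi z.
  by apply: is_derive_eq; rewrite /GRing.scale/=; lra.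
by rewrite subr_ge0; have := phi_le_expR true z; rewrite expr1 mulN1r.
Qed.

Lemma Phi_ge0 (x : R) : 0 <= Phi x. Proof. exact: fine_ge0. Qed.

Lemma Phi_le1 (x : R) : Phi x <= 1.
Proof.
rewrite -lee_fin fineK; first exact: probability_le1.
by rewrite fin_num_measure.
Qed.

End Normal.

(** * Binomial tails *)

Section BinomialTail.
Variable R : realType.
Implicit Types (n b : nat) (p : R).

(** P(Bin(n, p) >= b), conditioned on one trial. The truncated predecessor [b.-1] keeps the value 1
    once the threshold has reached 0. *)
Fixpoint btail n b p : R :=
  if n is n'.+1 then p * btail n' b.-1 p + (1 - p) * btail n' b p else (b == 0)%:R.

Definition bpmf n b p : R := 'C(n, b)%:R * p ^+ b * (1 - p) ^+ (n - b).

Lemma btail0 n p : btail n 0 p = 1.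
Proof. by elim: n => //= n ->; ring. Qed.

Lemma bpmfS n b p :
  bpmf n.+1 b.+1 p = p * bpmf n b p + (1 - p) * bpmf n b.+1 p.
Proof.
rewrite /bpmf binS natrD subSS.
have [bn|nb] := ltnP b n; first by rewrite -(subnSK bn) !exprS; ring.
by rewrite (@bin_small n b.+1)// exprS; ring.
Qed.

Lemma btail_bpmf n b p : btail n b p - btail n b.+1 p = bpmf n b p.
Proof.
elim: n b => [|n IH] [|b] /=.
- by rewrite /bpmf bin0 !expr0 subr0 !mulr1.
- by rewrite /bpmf bin_small// subr0 !mul0r.
- rewrite !btail0; have := IH 0; rewrite btail0 => /eqP.
  rewrite subr_eq addrC -subr_eq => /eqP <-.
  by rewrite /bpmf !bin0 !subn0 !expr0 !mulr1 !mul1r exprS; ring.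
- by rewrite bpmfS -!IH; ring.
Qed.

(** The derivatives of the masses telescope and leave the boundary monomial at [b]. In the
    induction, the product rule produces a difference of consecutive tails, which is a mass by
    [btail_bpmf]; the rest is absorption identities for binomial coefficients. *)
Lemma is_derive_btail n b p :
  is_derive p (1:R) (btail n b) (b%:R * 'C(n, b)%:R * p ^+ b.-1 * (1 - p) ^+ (n - b)).
Proof.
elim: n b p => [|n IH] [|b] p /=.
- by rewrite !mul0r; exact: is_derive_cst.
- by rewrite bin_small// mulr0 !mul0r; exact: is_derive_cst.
- have ? := IH 0 p; apply: is_derive_eq.
  by rewrite /GRing.scale/= !btail0; ring.
have ? := IH b p; have ? := IH b.+1 p; apply: is_derive_eq.
have := btail_bpmf n b p; rewrite /GRing.scale/= => /eqP.
rewrite subr_eq => /eqP ->; rewrite subSS /bpmf.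
have -> : b.+1%:R * 'C(n.+1, b.+1)%:R = n.+1%:R * 'C(n, b)%:R :> R.
  by rewrite -!natrM -mul_bin_diag.
have [bn|nb] := ltnP b n; last first.
  rewrite (@bin_small n b.+1)//.
  move: nb; rewrite leq_eqVlt => /predU1P[->|nb]; last first.
    by rewrite (@bin_small n b)//; ring.
  rewrite subnn expr0 binn -(natr1 b); case: (b) => [|k]/=; rewrite ?exprS; ring.
have -> : b.+1%:R * 'C(n, b.+1)%:R = (n - b)%:R * 'C(n, b)%:R :> R.
  by rewrite -!natrM mul_bin_left.
have -> : n.+1%:R = b%:R + (n - b.+1).+1%:R + 1 :> R.
  by rewrite subnSK// -natrD subnKC ?(ltnW bn)// -natr1.
rewrite -(subnSK bn) !exprS -!(natr1 (n - b.+1)) ?succnK.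
by case: (b) => [|k]/=; rewrite ?exprS; ring.
Qed.

(* The derivative of [btail n b] in [p], in a form suited to inductions on [n]. *)
Fixpoint btail_diff n b p : R :=
  if n is n'.+1 then p * btail_diff n' b.-1 p + (1 - p) * btail_diff n' b p
                     + (btail n' b.-1 p - btail n' b p)
  else 0.

Lemma btail_diffE n b p :
  btail_diff n b p = b%:R * 'C(n, b)%:R * p ^+ b.-1 * (1 - p) ^+ (n - b).
Proof.
have H : is_derive p (1:R) (btail n b) (btail_diff n b p).
  elim: n b => [|n IH] b /=; first exact: is_derive_cst.
  have ? := IH b; have ? := IH b.-1; apply: is_derive_eq.
  by rewrite /GRing.scale/=; ring.
by rewrite -(@derive_val _ _ _ _ _ _ _ H) (@derive_val _ _ _ _ _ _ _ (is_derive_btail n b p)).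
Qed.

Lemma btail_ge0_le1 n b p : 0 <= p <= 1 -> 0 <= btail n b p <= 1.
Proof.
move=> p01; elim: n b => [|n IH] b /=; first by rewrite ler0n lern1 leq_b1.
move: (IH b.-1) (IH b) p01 => /andP[A0 A1] /andP[B0 B1] /andP[p0 p1].
by apply/andP; split; nra.
Qed.

Lemma btail_gt n b p : (n < b)%N -> btail n b p = 0.
Proof.
elim: n b => [|n IH] [|b] //= nb.
by rewrite !IH ?(ltnW nb)//; ring.
Qed.

Lemma btail_chernoff n b p : (b <= n)%N -> 0 <= p <= 2^-1 ->
  btail n b p <= (2 * p) ^+ b * (2 * (1 - p)) ^+ (n - b).
Proof.
move=> + p01; have p2 : 1 <= 2 * (1 - p) by lra.
elim: n b => [|n IH] [|b] //= bn; first by rewrite !expr0 mulr1.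
  have := btail0 n.+1 p; rewrite /= => ->.
  by rewrite expr0 mul1r exprn_ege1.
have A := IH _ bn; rewrite subSS.
have B : btail n b.+1 p <= (2 * p) ^+ b.+1 * (2 * (1 - p)) ^+ (n - b.+1).
  have [/IH//|nb] := ltnP b n; rewrite btail_gt// mulr_ge0// exprn_ge0; lra.
have [/subnSK E|nb] := ltnP b n.
  move: A B; rewrite -E !exprS.
  set x := _ ^+ b; set y := _ ^+ (n - b.+1) => A B; nra.
rewrite (@btail_gt n b.+1)// mulr0 addr0 exprS -mulrA.
have p0 : 0 <= p by lra.
apply: le_trans (ler_wpM2l p0 A) _.
have : 0 <= (2 * p) ^+ b * (2 * (1 - p)) ^+ (n - b) by rewrite mulr_ge0// exprn_ge0; lra.
by nra.
Qed.

Lemma btail_chernoffC n b p : (b <= n)%N -> 2^-1 <= p <= 1 ->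
  1 - btail n b p <= (2 * p) ^+ b * (2 * (1 - p)) ^+ (n - b).
Proof.
move=> + p01; have p2 : 1 <= 2 * p by lra.
elim: n b => [|n IH] [|b] //= bn; first by rewrite subrr !expr0 mulr1.
  have := btail0 n.+1 p; rewrite /= => ->.
  by rewrite subrr expr0 mul1r exprn_ge0//; lra.
have [/[dup] /IH B /subnSK E|nb] := ltnP b n; last first.
  have -> : b = n by apply/eqP; rewrite eqn_leq -ltnS bn.
  rewrite subnn expr0 mulr1.
  have : 1 <= (2 * p) ^+ n.+1 by rewrite exprn_ege1.
  have : 0 <= p <= 1 by lra.
  by move=> /[dup] /(btail_ge0_le1 n n) + /(btail_ge0_le1 n n.+1); nra.
have A := IH _ bn; rewrite subSS.
move: A B; rewrite -E !exprS.
set x := _ ^+ b; set y := _ ^+ (n - b.+1) => A B; nra.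
Qed.

End BinomialTail.

(** * Taylor remainders of the exponential and the logarithm *)

Section Taylor.
Variable R : realType.

Definition exp_poly (m : nat) (y : R) : R := \sum_(k < m) y ^+ k / k`!%:R.

Lemma is_derive_exp_poly m (y : R) :
  is_derive y (1:R) (exp_poly m.+1) (exp_poly m y).
Proof.
elim: m => [|m IH].
  have -> : exp_poly 1 = cst (1:R).
    by apply/funext => z; rewrite /exp_poly big_ord1 expr0 fact0 invr1 mulr1.
  by rewrite /exp_poly big_ord0; exact: is_derive_cst.
have -> : exp_poly m.+2 = (fun z => exp_poly m.+1 z + z ^+ m.+1 / m.+1`!%:R).
  by apply/funext => z; rewrite /exp_poly big_ord_recr.
have H : is_derive y (1:R) (fun z : R => z ^+ m.+1 / m.+1`!%:R) (y ^+ m / m`!%:R).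
  have ? : is_derive y (1:R) (fun z : R => z ^+ m.+1) (m.+1%:R * y ^+ m *: 1).
    have -> : (fun z : R => z ^+ m.+1) = (id : R -> R) ^+ m.+1.
      by apply/funext => z; rewrite fctE.
    exact: is_deriveX.
  apply: is_derive_eq; rewrite /GRing.scale/= factS natrM; field.
  by rewrite -[1]/(1%:R) -natrD !pnatr_eq0 -lt0n fact_gt0.
rewrite {2}/exp_poly big_ord_recr/=.
exact: (@is_deriveD R R R (exp_poly m.+1) _ y 1 _ _ IH H).
Qed.

Lemma norm_between0 (x z : R) : (0 <= z <= x) || (x <= z <= 0) -> `|z| <= `|x|.
Proof.
by case/orP => /andP[? ?]; [rewrite !ger0_norm|rewrite !ler0_norm]; lra.
Qed.

(** The remainder of order [m] is the derivative of the remainder of order [m+1], so each induction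
    step is one mean value estimate; the factor [1/m!] is given up. *)
Lemma exp_taylor m (y : R) : `|y| <= 1 ->
  `|expR y - exp_poly m y| <= expR 1 * `|y| ^+ m.
Proof.
elim: m y => [|m IH] y y1.
  rewrite /exp_poly big_ord0 subr0 expr0 mulr1 ger0_norm ?expR_ge0// ler_expR.
  exact: le_trans (ler_norm _) y1.
pose f (z : R) := expR z - exp_poly m.+1 z.
have f0 : f 0 = 0.
  rewrite /f expR0 /exp_poly big_ord_recl/= expr0 fact0 invr1 mulr1.
  by rewrite big1 ?addr0 ?subrr// => i _; rewrite exprS mul0r mul0r.
have := @mean_value_le R f (fun z => expR z - exp_poly m z) (expR 1 * `|y| ^+ m) 0 y.
rewrite f0 !subr0 exprSr mulrA; apply => z zy.
  by have ? := is_derive_exp_poly m z; rewrite /f; apply: is_derive_eq.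
have zy' := norm_between0 zy.
apply: le_trans (IH _ (le_trans zy' y1)) _.
by rewrite ler_wpM2l ?expR_ge0// lerXn2r// nnegrE.
Qed.

(** The remainder has the exact derivative [-z^5/(1+z)], and [1+z >= 1/2]. Order six is what the
    window requires: there [x = O(w^8)], and summing over about [n = w^-18] factors turns [x^6] into
    [w^30], within the tolerance [w^28], while an unresolved [x^5] would leave [w^22]. *)
Lemma ln_taylor (x : R) : `|x| <= 2^-1 ->
  `|ln (1 + x) - (x - x ^+ 2 / 2 + x ^+ 3 / 3 - x ^+ 4 / 4 + x ^+ 5 / 5)|
  <= 2 * `|x| ^+ 6.
Proof.
move=> x12; pose f (z : R) :=
  ln (1 + z) - (z - z ^+ 2 / 2 + z ^+ 3 / 3 - z ^+ 4 / 4 + z ^+ 5 / 5).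
have f0 : f 0 = 0 by rewrite /f addr0 ln1 !exprS; ring.
have := @mean_value_le R f (fun z => - z ^+ 5 / (1 + z)) (2 * `|x| ^+ 5) 0 x.
rewrite f0 !subr0 [_ ^+ 6]exprSr mulrA; apply => z zx.
all: have zx' := norm_between0 zx.
all: have z1 : 2^-1 <= 1 + z
  by have := ler_norm (- z); rewrite normrN; lra.
  have z0 : 0 < 1 + z by lra.
  have ? : is_derive (1 + z) (1:R) (@ln R) (1 + z)^-1 by exact: is_derive1_ln.
  rewrite /f; apply: is_derive_eq; rewrite /GRing.scale/=; field.
  by rewrite gt_eqF.
rewrite normrM normrN normrX mulrC; apply: ler_pM => //.
  by rewrite normfV ger0_norm; [rewrite invf_ple ?posrE; lra|lra].
by rewrite lerXn2r// nnegrE.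
Qed.

End Taylor.

(** * Orders of magnitude along sequences *)

Section BigO.
Variable R : realType.
Implicit Types (w F G : nat -> R) (k l : nat).

(** The gauge [w] is a parameter so that fractional powers of [n] become natural powers of the
    gauge: [n^(-1/18)] for the window estimates, [n^(-1/2)] afterwards. *)
Definition Oseq w k F : Prop :=
  exists C : R, \forall n \near \oo, `|F n| <= C * w n ^+ k.

Definition small w : Prop := \forall n \near \oo, 0 < w n <= 1.

Lemma Oseq_pos w k F : Oseq w k F -> small w ->
  exists2 C : R, 0 <= C & \forall n \near \oo, `|F n| <= C * w n ^+ k.
Proof.
move=> [C HC] w01; exists (Num.max C 0); first by rewrite le_max lexx orbT.
near=> n; apply: (@le_trans _ _ (C * w n ^+ k)); first by near: n.
rewrite ler_wpM2r ?le_max ?lexx// exprn_ge0//.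
by have /andP[/ltW] : 0 < w n <= 1 by near: n.
Unshelve. all: by end_near. Qed.

Lemma Oseq_le w k F G : (\forall n \near \oo, `|F n| <= `|G n|) ->
  Oseq w k G -> Oseq w k F.
Proof.
move=> FG [C HC]; exists C; near=> n.
by apply: (@le_trans _ _ `|G n|); near: n.
Unshelve. all: by end_near. Qed.

Lemma Oseq_eq w k F G : (\forall n \near \oo, F n = G n) ->
  Oseq w k G -> Oseq w k F.
Proof. by move=> FG; apply: Oseq_le; apply: filterS FG => n ->. Qed.

Lemma Oseq_cst w c : Oseq w 0 (fun=> c).
Proof. by exists `|c|; near=> n; rewrite expr0 mulr1. Unshelve. all: by end_near. Qed.

Lemma OseqD w k F G : Oseq w k F -> Oseq w k G -> Oseq w k (fun n => F n + G n).
Proof.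
move=> [C HC] [D HD]; exists (C + D); near=> n.
rewrite mulrDl; apply: le_trans (ler_normD _ _) _.
by apply: lerD; near: n.
Unshelve. all: by end_near. Qed.

Lemma OseqN w k F : Oseq w k F -> Oseq w k (fun n => - F n).
Proof. by move=> [C HC]; exists C; apply: filterS HC => n; rewrite normrN. Qed.

Lemma OseqB w k F G : Oseq w k F -> Oseq w k G -> Oseq w k (fun n => F n - G n).
Proof. by move=> HF HG; apply: OseqD => //; exact: OseqN. Qed.

Lemma OseqM w k l F G : Oseq w k F -> Oseq w l G ->
  Oseq w (k + l) (fun n => F n * G n).
Proof.
move=> [C HC] [D HD]; exists (C * D); near=> n.
rewrite normrM exprD mulrACA.
by apply: ler_pM => //; near: n.
Unshelve. all: by end_near. Qed.

Lemma OseqM0 w k F G : Oseq w 0 F -> Oseq w k G -> Oseq w k (fun n => F n * G n).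
Proof. exact: (@OseqM w 0 k). Qed.

Lemma OseqM0r w k F G : Oseq w k F -> Oseq w 0 G -> Oseq w k (fun n => F n * G n).
Proof. by move=> HF HG; have := OseqM HF HG; rewrite addn0. Qed.

Lemma OseqX w F k : Oseq w 0 F -> Oseq w 0 (fun n => F n ^+ k).
Proof.
move=> HF; elim: k => [|k IH]; first exact: Oseq_cst.
by apply: Oseq_eq (OseqM0 HF IH); near=> n; rewrite exprS.
Unshelve. all: by end_near. Qed.

Lemma OseqXw w k : small w -> Oseq w k (fun n => w n ^+ k).
Proof.
move=> w01; exists 1; near=> n; rewrite mul1r ger0_norm// exprn_ge0//.
by have /andP[/ltW] : 0 < w n <= 1 by near: n.
Unshelve. all: by end_near. Qed.

Lemma Oseq_wM w k F : small w -> Oseq w 0 F -> Oseq w k (fun n => w n ^+ k * F n).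
Proof. by move=> w01 HF; have := OseqM (OseqXw k w01) HF; rewrite addn0. Qed.

Lemma OseqW w k l F : small w -> (l <= k)%N -> Oseq w k F -> Oseq w l F.
Proof.
move=> w01 lk /Oseq_pos /(_ w01) [C C0 HC]; exists C; near=> n.
apply: (@le_trans _ _ (C * w n ^+ k)); first by near: n.
rewrite ler_wpM2l//; have /andP[w0 w1] : 0 < w n <= 1 by near: n.
by apply: ler_wiXn2l; rewrite // ltW.
Unshelve. all: by end_near. Qed.

Lemma Oseq_base w : small w -> Oseq w 0 w.
Proof. by move=> w01; apply: OseqW (OseqXw 1 w01). Qed.

Lemma Oseq_divX w k F : small w -> Oseq w k F -> Oseq w 0 (fun n => F n / w n ^+ k).
Proof.
move=> w01 [C HC]; exists C; near=> n.
have /andP[w0 w1] : 0 < w n <= 1 by near: n.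
rewrite expr0 mulr1 normrM normfV (@ger0_norm _ (w n ^+ k)) ?exprn_ge0 ?(ltW w0)//.
by rewrite ler_pdivrMr ?exprn_gt0//; near: n.
Unshelve. all: by end_near. Qed.

Lemma Oseq_base_change w v m k F : (\forall n \near \oo, v n = w n ^+ m) ->
  Oseq w (m * k) F -> Oseq v k F.
Proof.
move=> vw [C HC]; exists C; near=> n.
have -> : v n = w n ^+ m by near: n.
by rewrite -exprM; near: n.
Unshelve. all: by end_near. Qed.

Lemma Oseq_exp w F : small w -> Oseq w 0 F -> Oseq w 0 (fun n => expR (F n)).
Proof.
move=> w01 [C HC]; exists (expR C); near=> n.
rewrite expr0 mulr1 ger0_norm ?expR_ge0// ler_expR.
apply: le_trans (ler_norm _) _.
by rewrite -[leRHS]mulr1 -(expr0 (w n)); near: n.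
Unshelve. all: by end_near. Qed.

Definition vanishing w : Prop := forall d : R, 0 < d -> \forall n \near \oo, w n <= d.

Lemma Oseq_near w F (d : R) : small w -> vanishing w -> Oseq w 1 F -> 0 < d ->
  \forall n \near \oo, `|F n| <= d.
Proof.
move=> w01 w0 /Oseq_pos /(_ w01) [C C0 HC] d0.
have C1 : 0 < C + 1 by lra.
have := w0 (d / (C + 1)) (divr_gt0 d0 C1) => wd.
near=> n; apply: (@le_trans _ _ (C * w n)).
  by rewrite -[w n]expr1; near: n.
have : w n <= d / (C + 1) by near: n.
rewrite ler_pdivlMr// => H.
have : 0 < w n <= 1 by near: n.
by nra.
Unshelve. all: by end_near. Qed.

Lemma Oseq_inv1 w k F : small w -> vanishing w ->
  Oseq w k.+1 (fun n => F n - 1) -> Oseq w k.+1 (fun n => (F n)^-1 - 1).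
Proof.
move=> w01 w0 HF.
have H1 : Oseq w 1 (fun n => F n - 1) by exact: OseqW HF.
have h := @Oseq_near w _ 2^-1 w01 w0 H1 _.
apply: (@Oseq_le _ _ _ (fun n => 2 * (F n - 1))); last first.
  exact: OseqM0 (Oseq_cst _ _) HF.
near=> n.
have : `|F n - 1| <= 2^-1 by near: n; apply: h; lra.
rewrite ler_norml => Fn; have F0 : 0 < F n by lra.
have -> : (F n)^-1 - 1 = (F n)^-1 * - (F n - 1) by field; rewrite gt_eqF.
rewrite !normrM normrN ler_wpM2r// !ger0_norm ?invr_ge0//; last exact: ltW.
by rewrite invf_ple ?posrE; lra.
Unshelve. all: by end_near. Qed.

End BigO.

Ltac Oseq0 :=
  match goal with
  | H : Oseq ?w 0 ?F |- Oseq ?w 0 ?F => exact H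
  | H : Oseq ?w 0 ?F |- Oseq ?w 0 (fun n => ?F n) => exact H
  | |- Oseq _ 0 (fun=> ?c) => exact: Oseq_cst
  | |- Oseq _ 0 (fun n => _ + _) => apply: OseqD; Oseq0
  | |- Oseq _ 0 (fun n => - _) => apply: OseqN; Oseq0
  | |- Oseq _ 0 (fun n => _ * _) => apply: OseqM0; Oseq0
  | |- Oseq _ 0 (fun n => _ ^+ _) => apply: OseqX; Oseq0
  | _ => first [eassumption | by apply: Oseq_base | idtac]
  end.

(** * Edgeworth expansion of binomial tails *)

Section EdgeworthTerms.
Variable R : realType.
Implicit Types e z x s : R.

(* [1 + e ^+ 2 * edge_h s z] corrects the Gaussian density to second order;
   [edge_poly] and the constant [edge_c] are the solution of
   d/ds edge_poly - (s - z) edge_poly = edge_c + edge_h. *)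
Definition edge_poly s z : R :=
  s ^+ 3 / 4 - z * s ^+ 2 / 12 + (1 / 4 - z ^+ 2 / 12) * s + (z - z ^+ 3) / 12.
Definition edge_h s z : R := s ^+ 2 / 2 - s ^+ 4 / 4 + z * s ^+ 3 / 3.
Definition edge_c z : R := 1 / 4 - z ^+ 4 / 12.
Definition edge_F e z x : R := Phi (x - z) + e ^+ 2 * phi (x - z) * edge_poly x z.
Definition edge_f e z x : R := phi (x - z) * (1 + e ^+ 2 * (edge_c z + edge_h x z)).

Lemma is_derive_edge_F e z x : is_derive x (1:R) (edge_F e z) (edge_f e z x).
Proof.
have ? := is_derive_phi (x - z); have ? := is_derive_Phi (x - z).
rewrite /edge_F /edge_poly; apply: is_derive_eq.
by rewrite /edge_f /edge_c /edge_h /GRing.scale/=; field.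
Qed.

Lemma phiB x z : phi (x - z) =
  expR (- x ^+ 2 / 2 + z * x) * (expR (- z ^+ 2 / 2) / Num.sqrt (2 * pi)).
Proof. by rewrite /phi mulrA -expRD; congr (expR _ / _); field. Qed.

Lemma mean_value_between (f df : R -> R) (x y : R) :
  (forall t, is_derive t (1:R) f (df t)) ->
  exists c, `|c| <= `|x| + `|y| /\ f y - f x = df c * (y - x).
Proof.
move=> fd.
have [xy|/ltW yx] := leP x y.
  have [c] := mean_value xy (fun t _ => fd t).
  rewrite in_itv/= => /andP[xc cy] ->; exists c; split => //.
  by rewrite ler_norml; have := ler_norm (- x); have := ler_norm y;
     rewrite normrN; have := normr_ge0 x; have := normr_ge0 y; lra.
have [c] := mean_value yx (fun t _ => fd t).
rewrite in_itv/= => /andP[xc cy] E; exists c; split.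
  by rewrite ler_norml; have := ler_norm (- y); have := ler_norm x;
     rewrite normrN; have := normr_ge0 x; have := normr_ge0 y; lra.
by rewrite -opprB E; ring.
Qed.

End EdgeworthTerms.

Section Edgeworth.
Variable R : realType.
Implicit Types t x y : nat -> R.

(* With w = n^(-1/18) and the window |s| <= 1/w, the relative error n^-2 s^8
   integrates to w^36 w^-8 w^-1 = w^27 = n^(-3/2). *)
Definition root18 (n : nat) : R := n%:R `^ (- (18%:R)^-1).
Local Notation w := root18.

Lemma root18_gt0 n : (0 < n)%N -> 0 < w n.
Proof. by move=> n0; rewrite powR_gt0// ltr0n. Qed.

Lemma root18X n : (0 < n)%N -> w n ^+ 18 = n%:R^-1.
Proof.
move=> n0; rewrite -powR_mulrn ?powR_ge0// -powRrM mulNr mulVf ?pnatr_eq0//.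
by rewrite powR_inv1.
Qed.

Lemma root18_sqrt n : (0 < n)%N -> w n ^+ 9 = (Num.sqrt n%:R)^-1.
Proof.
move=> n0; apply/eqP; rewrite -(@eqrXn2 _ 2)// ?exprn_ge0 ?powR_ge0 ?invr_ge0 ?sqrtr_ge0//.
by rewrite -exprM root18X// exprVn sqr_sqrtr// ler0n.
Qed.

Lemma small_root18 : small w.
Proof.
exists 1 => // n /= n0; rewrite root18_gt0//=.
rewrite -(@ler_pXn2r _ 18)// ?nnegrE ?(ltW (root18_gt0 _))//.
by rewrite root18X// expr1n invf_le1 ?ltr0n// ler1n.
Qed.

Lemma vanishing_root18 : vanishing w.
Proof.
move=> d d0; near=> n.
have n0 : (0 < n)%N by near: n; exists 1.
rewrite -(@ler_pXn2r _ 18)// ?nnegrE ?(ltW (root18_gt0 _)) ?(ltW d0)//.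
rewrite root18X// -[leRHS]invrK lef_pV2 ?posrE ?invr_gt0 ?exprn_gt0 ?ltr0n//.
by near: n; exact: nbhs_infty_ger.
Unshelve. all: by end_near. Qed.

Let w01 := small_root18.
Let w0 := vanishing_root18.

Lemma Oseq_div1 k (F : nat -> R) : Oseq w k.+1 F -> Oseq w k (fun n => F n / w n).
Proof.
move=> HF; apply: Oseq_eq (Oseq_wM k w01 (Oseq_divX w01 HF)); near=> n.
have wn : 0 < w n by apply: root18_gt0; near: n; exists 1.
have wk : w n ^+ k != 0 by rewrite expf_neq0 ?gt_eqF.
by rewrite exprS; field; rewrite wk gt_eqF.
Unshelve. all: by end_near. Qed.

Lemma Oseq_expN k : Oseq w k (fun n => expR (- (w n)^-1)).
Proof.
exists k.+1`!%:R; near=> n.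
have wn : 0 < w n <= 1 by near: n.
have [w0' w1] := andP wn.
rewrite ger0_norm ?expR_ge0// expRN invf_ple ?posrE ?expR_gt0//; last first.
  by rewrite mulr_gt0 ?exprn_gt0// ltr0n fact_gt0.
have wV : 1 <= (w n)^-1 by rewrite invf_ge1.
have wV0 : 0 <= (w n)^-1 by lra.
have H := expR_ge1Dxn k wV0.
apply: le_trans H; rewrite invfM mulrC -exprVn.
apply: le_trans (_ : (w n)^-1 ^+ k.+1 / k.+1`!%:R <= _); last by rewrite lerDr.
by rewrite ler_wpM2r// ler_weXn2l.
Unshelve. all: by end_near. Qed.

Lemma Oseq_gauss k t : Oseq w 0 t ->
  Oseq w k (fun n => expR (- ((w n)^-1) ^+ 2 / 2 + t n / w n)).
Proof.
move=> /Oseq_pos /(_ w01) [C C0 HC].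
(* Completing the square: [-y^2/2 + C y <= (C+1)^2/2 - y]. *)
apply: (@Oseq_le _ _ _ _ (fun n => expR ((C + 1) ^+ 2 / 2) * expR (- (w n)^-1))); last first.
  exact: OseqM0 (Oseq_cst _ _) (Oseq_expN k).
near=> n.
have wn : 0 < w n <= 1 by near: n.
rewrite normrM !(@ger0_norm _ (expR _)) ?expR_ge0// -expRD ler_expR.
have : `|t n| <= C * w n ^+ 0 by near: n.
rewrite expr0 mulr1 => tC.
have wV : 0 < (w n)^-1 by rewrite invr_gt0; lra.
have : t n <= C by exact: le_trans (ler_norm _) tC.
set y := (w n)^-1 in wV * => tC'.
have H1 : t n * y <= C * y by rewrite ler_wpM2r// ltW.
have := sqr_ge0 (y - (C + 1)); lra.
Unshelve. all: by end_near. Qed.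

Variables (b : nat -> nat) (z : nat -> R).
Hypothesis bz : \forall n \near \oo, 2 * (b n)%:R - n%:R - 1 = z n * Num.sqrt n%:R.
Hypothesis z_bounded : Oseq w 0 z.

Let e n : R := w n ^+ 9.

Lemma near_nat : \forall n \near \oo, [/\ (0 < n)%N, 0 < w n, w n <= 1,
  n%:R = (w n ^+ 18)^-1 :> R & (b n)%:R = ((w n ^+ 18)^-1 + 1 + z n / w n ^+ 9) / 2].
Proof.
near=> n.
have n0 : (0 < n)%N by near: n; exists 1.
have /andP[? ?] : 0 < w n <= 1 by near: n.
split => //; first by rewrite root18X// invrK.
have : 2 * (b n)%:R - n%:R - 1 = z n * Num.sqrt n%:R by near: n.
rewrite root18X// invrK root18_sqrt// invrK; lra.
Unshelve. all: by end_near. Qed.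

Lemma near_threshold : \forall n \near \oo, (0 < b n <= n)%N.
Proof.
have H : Oseq w 1 (fun n => w n ^+ 9 * z n).
  by apply: (@OseqW _ _ 9) => //; exact: Oseq_wM.
have h := @Oseq_near _ w _ 2^-1 w01 w0 H _.
near=> n.
have [n0 wn w1 En Eb] : [/\ (0 < n)%N, 0 < w n, w n <= 1,
  n%:R = (w n ^+ 18)^-1 :> R & (b n)%:R = ((w n ^+ 18)^-1 + 1 + z n / w n ^+ 9) / 2].
  by near: n; exact: near_nat.
have : `|w n ^+ 9 * z n| <= 2^-1 by near: n; apply: h; lra.
rewrite ler_norml => Hn.
have E : z n / w n ^+ 9 = (w n ^+ 9 * z n) * n%:R.
  by rewrite En; field; rewrite gt_eqF.
rewrite E -En in Eb.
have : 2 <= n%:R :> R by rewrite (ler_nat R 2); near: n; exists 2.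
move: Eb Hn; set y := _ * z n; set m : R := n%:R => Eb Hn m1.
have [? ?] : - (m / 2) <= y * m /\ y * m <= m / 2 by split; nra.
have [? ?] : 0 < (b n)%:R :> R /\ (b n)%:R <= m by rewrite Eb; split; lra.
by rewrite -(ltr0n R) -(ler_nat R); apply/andP.
Unshelve. all: by end_near. Qed.

(** Put [s = t / w], so that [s * e = t * w ^+ 8]. The two exponents add up to [n - 1] and differ by
    [z * sqrt n]; this is why [bz] subtracts 1. In the logarithm the sum of the exponents produces
    [-s^2/2] and their difference produces [z s]. What remains at order [1/n] is [edge_h]: [s^2/2]
    since there are only [n - 1] factors, and the quartic and cubic terms. This is [O(w ^+ 14)], so
    exponentiating it costs [O(w ^+ 28)]. *)
Lemma density_ratio t : Oseq w 0 t ->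
  Oseq w 28 (fun n => (1 + t n * w n ^+ 8) ^+ (b n).-1 * (1 - t n * w n ^+ 8) ^+ (n - b n)
    / expR (- (t n / w n) ^+ 2 / 2 + z n * (t n / w n))
    - (1 + e n ^+ 2 * edge_h (t n / w n) (z n))).
Proof.
move=> t_bounded; pose X n := t n * w n ^+ 8.
have XO : Oseq w 8 X by exact: OseqM0 t_bounded (OseqXw 8 w01).
have X1 : \forall n \near \oo, `|X n| <= 2^-1.
  by apply: (@Oseq_near _ w X) => //; exact: OseqW XO.
pose P (u : R) := u - u ^+ 2 / 2 + u ^+ 3 / 3 - u ^+ 4 / 4 + u ^+ 5 / 5.
pose r1 n := (ln (1 + X n) - P (X n)) / w n ^+ 48.
pose r2 n := (ln (1 - X n) - P (- X n)) / w n ^+ 48.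
have X6 : Oseq w 48 (fun n => 2 * X n ^+ 6).
  apply: OseqM0; first exact: Oseq_cst.
  by have := OseqM (OseqM (OseqM XO XO) (OseqM XO XO)) (OseqM XO XO);
     apply: Oseq_eq; near=> n; ring.
have r1O : Oseq w 0 r1.
  apply: Oseq_divX => //; apply: Oseq_le X6; near=> n.
  have Xn : `|X n| <= 2^-1 by near: n.
  by apply: le_trans (ln_taylor Xn) _; rewrite [leRHS]normrM [`|X n ^+ 6|]normrX (@ger0_norm _ 2).
have r2O : Oseq w 0 r2.
  apply: Oseq_divX => //; apply: Oseq_le X6; near=> n.
  have Xn : `|- X n| <= 2^-1 by rewrite normrN; near: n.
  by apply: le_trans (ln_taylor Xn) _; rewrite [leRHS]normrM [`|X n ^+ 6|]normrX (@ger0_norm _ 2)// normrN.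
pose y n := e n ^+ 2 * edge_h (t n / w n) (z n).
(* The exponent beyond [edge_h], divided by [w ^+ 30]: the remainders of the logarithms, where
   [48 - 18 = 30]; the quartic term owed to [n - 1] instead of [n] factors; and the quintic term,
   which survives only in the difference of the exponents. *)
pose rho n := (r1 n + r2 n) * (1 - w n ^+ 18) / 2 + t n ^+ 4 * w n ^+ 2 / 4
  + z n * t n ^+ 5 * w n / 5 + z n * (r1 n - r2 n) * w n ^+ 9 / 2.
have wO : Oseq w 0 w by exact: Oseq_base.
have rhoO : Oseq w 0 rho by rewrite /rho; Oseq0.
have yO : Oseq w 14 y.
  have HB : Oseq w 0 (fun n => t n ^+ 2 * w n ^+ 2 / 2 - t n ^+ 4 / 4 + z n * t n ^+ 3 * w n / 3).
    by Oseq0.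
  apply: Oseq_eq (Oseq_wM 14 w01 HB); near=> n.
  have [n0 wn w1 _ _] : [/\ (0 < n)%N, 0 < w n, w n <= 1,
    n%:R = (w n ^+ 18)^-1 :> R & (b n)%:R = ((w n ^+ 18)^-1 + 1 + z n / w n ^+ 9) / 2].
    by near: n; exact: near_nat.
  by rewrite /y /e /edge_h; field; rewrite gt_eqF.
pose Y n := y n + w n ^+ 30 * rho n.
have YO : Oseq w 14 Y.
  apply: OseqD => //; apply: (@OseqW _ _ 30) => //; exact: Oseq_wM.
have Y1 : \forall n \near \oo, `|Y n| <= 1.
  by apply: (@Oseq_near _ w Y) => //; exact: OseqW YO.
have EO : Oseq w 28 (fun n => expR (Y n) - 1 - Y n).
  apply: (@Oseq_le _ _ _ _ (fun n => expR 1 * (Y n * Y n))); last first.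
    by apply: OseqM0; [exact: Oseq_cst|exact: (OseqM YO YO)].
  near=> n; have Yn : `|Y n| <= 1 by near: n.
  have := exp_taylor 2 Yn.
  rewrite /exp_poly !big_ord_recl big_ord0/= /bump/= !expr0 !expr1 !fact0 factS fact0.
  rewrite !divr1 addr0 opprD addrA => /le_trans; apply.
  by rewrite !normrM (@ger0_norm _ (expR 1)) ?expR_ge0 ?expr2.
have : Oseq w 28 (fun n => (expR (Y n) - 1 - Y n) + w n ^+ 30 * rho n).
  by apply: OseqD => //; apply: (@OseqW _ _ 30) => //; exact: Oseq_wM.
apply: Oseq_eq; near=> n.
have [n0 wn w1 En Eb] : [/\ (0 < n)%N, 0 < w n, w n <= 1,
    n%:R = (w n ^+ 18)^-1 :> R & (b n)%:R = ((w n ^+ 18)^-1 + 1 + z n / w n ^+ 9) / 2].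
  by near: n; exact: near_nat.
have /andP[b0 bn] : (0 < b n <= n)%N by near: n; exact: near_threshold.
have : `|X n| <= 2^-1 by near: n.
rewrite -/(X n) ler_norml => Xn.
have X1p : 0 < 1 + X n by lra.
have X1m : 0 < 1 - X n by lra.
rewrite -{1}[1 + X n]lnK ?posrE// -{1}[1 - X n]lnK ?posrE//.
rewrite -!expRM_natl -!expRD -expRB -/(y n).
have -> : (b n).-1%:R * ln (1 + X n) + (n - b n)%:R * ln (1 - X n)
   - (- (t n / w n) ^+ 2 / 2 + z n * (t n / w n)) = Y n; last by rewrite /Y; ring.
have -> : ln (1 + X n) = P (X n) + w n ^+ 48 * r1 n.
  by rewrite /r1; field; rewrite gt_eqF.
have -> : ln (1 - X n) = P (- X n) + w n ^+ 48 * r2 n.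
  by rewrite /r2; field; rewrite gt_eqF.
have -> : (b n).-1%:R = (b n)%:R - 1 :> R by rewrite -[in RHS](prednK b0) -natr1; ring.
rewrite natrB// En Eb /Y /y /rho /P /X /e /edge_h; field.
by rewrite gt_eqF.
Unshelve. all: by end_near. Qed.

Let tail n (u : R) : R := btail n (b n) ((1 + u * e n) / 2).
Let coef n : R := (b n)%:R * 'C(n, b n)%:R / 2 ^+ n * e n.

Definition tail_density n (u : R) : R :=
  coef n * (1 + u * e n) ^+ (b n).-1 * (1 - u * e n) ^+ (n - b n).

Lemma is_derive_tail n (u : R) : is_derive u (1:R) (tail n) (tail_density n u).
Proof.
rewrite /tail; have ? := is_derive_btail n (b n) ((1 + u * e n) / 2).
apply: is_derive_eq; rewrite /tail_density /coef /GRing.scale/=.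
have [nb|bn] := ltnP n (b n); first by rewrite bin_small//; ring.
case: (b n) bn => [|k] kn; first by ring.
have -> : (2:R) ^+ n = 2 * 2 ^+ k * 2 ^+ (n - k.+1) by rewrite -exprS -exprD subnKC.
rewrite /=.
have -> : 1 - (1 + u * e n) / 2 = (1 - u * e n) / 2 by field.
rewrite !exprMn !exprVn; field.
by rewrite !expf_neq0.
Qed.

Lemma tail_densityE n (u : R) :
  tail_density n u = btail_diff n (b n) ((1 + u * e n) / 2) * (e n / 2).
Proof.
have ? := is_derive_btail n (b n) ((1 + u * e n) / 2).
have H : is_derive u (1:R) (tail n) (btail_diff n (b n) ((1 + u * e n) / 2) * (e n / 2)).
  rewrite /tail btail_diffE; apply: is_derive_eq.
  by rewrite /GRing.scale/=; field.
by rewrite -(@derive_val _ _ _ _ _ _ _ H) (@derive_val _ _ _ _ _ _ _ (is_derive_tail n u)).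
Qed.

(* The ratio of the exact normalising constant to the Gaussian one. *)
Let kap n : R :=
  coef n * (Num.sqrt (2 * pi) * expR (z n ^+ 2 / 2)) / (1 + e n ^+ 2 * edge_c (z n)).

Lemma phi_le (x : R) : phi x <= (Num.sqrt (2 * pi))^-1.
Proof.
rewrite /phi -[leRHS]mul1r ler_wpM2r ?invr_ge0 ?sqrtr_ge0//.
by rewrite -[leRHS]expR0 ler_expR; have := sqr_ge0 x; lra.
Qed.

Lemma Oseq_phi v (x : nat -> R) : Oseq v 0 (fun n => phi (x n)).
Proof.
exists (Num.sqrt (2 * pi))^-1; near=> n.
by rewrite expr0 mulr1 ger0_norm ?phi_ge0 ?phi_le.
Unshelve. all: by end_near. Qed.

Let ec0 : \forall n \near \oo, 0 < 1 + e n ^+ 2 * edge_c (z n).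
Proof.
have H : Oseq w 18 (fun n => w n ^+ 18 * edge_c (z n)).
  by apply: Oseq_wM => //; rewrite /edge_c; Oseq0.
have H1 := OseqW w01 (isT : (1 <= 18)%N) H.
have := @Oseq_near _ w _ 2^-1 w01 w0 H1 _.
move=> h; near=> n.
have : `|w n ^+ 18 * edge_c (z n)| <= 2^-1 by near: n; apply: h; lra.
by rewrite ler_norml /e -exprM; lra.
Unshelve. all: by end_near. Qed.

Let coef_gt0 : \forall n \near \oo, 0 < coef n.
Proof.
near=> n.
have /andP[b0 bn] : (0 < b n <= n)%N by near: n; exact: near_threshold.
have wn : 0 < w n <= 1 by near: n.
have en : 0 < e n by rewrite exprn_gt0//; case/andP: wn.
by rewrite /coef mulr_gt0// divr_gt0 ?exprn_gt0// mulr_gt0 ?ltr0n ?bin_gt0.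
Unshelve. all: by end_near. Qed.

Let kap_gt0 : \forall n \near \oo, 0 < kap n.
Proof.
near=> n; have cn : 0 < coef n by near: n.
have ec : 0 < 1 + e n ^+ 2 * edge_c (z n) by near: n.
by rewrite /kap divr_gt0// mulr_gt0// mulr_gt0 ?expR_gt0 ?sqrt2pi_gt0.
Unshelve. all: by end_near. Qed.

Lemma density_error t : Oseq w 0 t ->
  Oseq w 28 (fun n => tail_density n (t n / w n) / kap n - edge_f (e n) (z n) (t n / w n)).
Proof.
move=> tO; have wO : Oseq w 0 w by exact: Oseq_base.
pose H n := t n ^+ 2 * w n ^+ 2 / 2 - t n ^+ 4 / 4 + z n * t n ^+ 3 * w n / 3.
have HO : Oseq w 0 H by rewrite /H; Oseq0.
pose A n := (1 + t n * w n ^+ 8) ^+ (b n).-1 * (1 - t n * w n ^+ 8) ^+ (n - b n)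
    / expR (- (t n / w n) ^+ 2 / 2 + z n * (t n / w n))
    - (1 + e n ^+ 2 * edge_h (t n / w n) (z n)).
have AO : Oseq w 28 A by exact: density_ratio.
pose ph n := phi (t n / w n - z n).
have phO : Oseq w 0 ph by exact: Oseq_phi.
have HB : Oseq w 28 (fun n => ph n * (A n * (1 + w n ^+ 18 * edge_c (z n))
   + w n ^+ 28 * (w n ^+ 4 * H n * edge_c (z n)))).
  apply: OseqM0 => //; apply: OseqD.
    by apply: OseqM0r => //; rewrite /edge_c; Oseq0.
  by apply: Oseq_wM => //; rewrite /edge_c; Oseq0.
apply: Oseq_eq HB; near=> n.
have [n0 wn w1 En Eb] : [/\ (0 < n)%N, 0 < w n, w n <= 1,
    n%:R = (w n ^+ 18)^-1 :> R & (b n)%:R = ((w n ^+ 18)^-1 + 1 + z n / w n ^+ 9) / 2].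
  by near: n; exact: near_nat.
have cn : 0 < coef n by near: n.
have ecn : 0 < 1 + e n ^+ 2 * edge_c (z n) by near: n.
have Ex : t n / w n * e n = t n * w n ^+ 8 by rewrite /e; field; rewrite gt_eqF.
have Eh : e n ^+ 2 * edge_h (t n / w n) (z n) = w n ^+ 14 * H n.
  by rewrite /edge_h /e /H; field; rewrite gt_eqF.
have -> : edge_f (e n) (z n) (t n / w n) =
    phi (t n / w n - z n) * (1 + e n ^+ 2 * edge_c (z n) + w n ^+ 14 * H n).
  by rewrite /edge_f -Eh; ring.
rewrite /A Eh /tail_density /kap Ex /ph phiB.
move: cn ecn; rewrite /e -exprM.
set c := coef n; set c0 := edge_c _; set U := _ ^+ (b n).-1; set V := _ ^+ (n - _).
rewrite -[z n ^+ 2 / 2]opprK -mulNr expRN.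
set E1 := expR (_ + _); set E2 := expR _ => cn ecn.
field.
by rewrite !gt_eqF ?expR_gt0 ?sqrt2pi_gt0.
Unshelve. all: by end_near. Qed.

(** [tail / kap - edge_F] has a derivative of size [O(w ^+ 28)] throughout the window, whose length
    [O(1/w)] costs one power. An intermediate point [c n] is selected for each [n], so that
    [density_error], a statement about sequences, applies with [t = c * w]. *)
Lemma increment_error (x y : nat -> R) :
  Oseq w 0 (fun n => x n * w n) -> Oseq w 0 (fun n => y n * w n) ->
  Oseq w 27 (fun n => (tail n (y n) - tail n (x n)) / kap n
    - (edge_F (e n) (z n) (y n) - edge_F (e n) (z n) (x n))).
Proof.
move=> xO yO.
pose f n u := tail n u / kap n - edge_F (e n) (z n) u.
pose df n u := tail_density n u / kap n - edge_f (e n) (z n) u.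
have fd n u : is_derive u (1:R) (f n) (df n u).
  have ? := is_derive_tail n u; have ? := is_derive_edge_F (e n) (z n) u.
  by apply: is_derive_eq; rewrite /df /GRing.scale/=; ring.
have [c cP] := choice (fun n => mean_value_between (x n) (y n) (fd n)).
have cO : Oseq w 0 (fun n => c n * w n).
  apply: (@Oseq_le _ _ _ _ (fun n => `|x n * w n| + `|y n * w n|)).
    near=> n; rewrite !normrM -mulrDl normrM normr_id ler_wpM2r//.
    by rewrite [leRHS]ger0_norm ?addr_ge0//; have [] := cP n.
  apply: OseqD; [apply: Oseq_le xO|apply: Oseq_le yO]; near=> n; by rewrite normr_id.
have dO := density_error cO.
have HB : Oseq w 27 (fun n => (df n (c n) / w n) * (y n * w n - x n * w n)).
  apply: OseqM0r; last exact: OseqB.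
  apply: Oseq_div1; apply: Oseq_eq dO; near=> n.
  have wn : 0 < w n <= 1 by near: n.
  by rewrite mulfK// gt_eqF//; case/andP: wn.
apply: Oseq_eq HB; near=> n.
have /andP[wn _] : 0 < w n <= 1 by near: n.
have [_] := cP n; rewrite /f => E.
have -> : df n (c n) / w n * (y n * w n - x n * w n) = df n (c n) * (y n - x n).
  by field; rewrite gt_eqF.
by rewrite -E; ring.
Unshelve. all: by end_near. Qed.

(** At the ends [s = 1/w] and [s = -1/w] of the window, [density_ratio] still controls the monomial,
    and the Gaussian factor there is below every power of [w]. Together with the Chernoff bounds
    this settles everything beyond the window. *)
Lemma density_base_small t k : Oseq w 0 t -> (forall n, t n ^+ 2 = 1) ->
  Oseq w k (fun n => (1 + t n * w n ^+ 8) ^+ (b n).-1 * (1 - t n * w n ^+ 8) ^+ (n - b n)).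
Proof.
move=> tO t2; have wO : Oseq w 0 w by exact: Oseq_base.
pose G n := expR (- (t n / w n) ^+ 2 / 2 + z n * (t n / w n)).
pose B n := (1 + t n * w n ^+ 8) ^+ (b n).-1 * (1 - t n * w n ^+ 8) ^+ (n - b n).
have r1 : Oseq w 0 (fun n => B n / G n - (1 + e n ^+ 2 * edge_h (t n / w n) (z n))).
  by apply: (@OseqW _ _ 28) => //; exact: density_ratio.
have hO : Oseq w 0 (fun n => t n ^+ 2 * w n ^+ 16 / 2 - t n ^+ 4 * w n ^+ 14 / 4
    + z n * t n ^+ 3 * w n ^+ 15 / 3) by Oseq0.
have GO : Oseq w k G.
  have ztO : Oseq w 0 (fun n => z n * t n) by Oseq0.
  apply: Oseq_eq (Oseq_gauss k ztO); near=> n.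
  by rewrite /G exprMn t2 mul1r mulrA.
have rO : Oseq w 0 (fun n => B n / G n).
  have HB := OseqD (OseqD r1 (Oseq_cst w 1)) hO.
  apply: Oseq_eq HB; near=> n.
  have /andP[wn _] : 0 < w n <= 1 by near: n.
  have -> : e n ^+ 2 * edge_h (t n / w n) (z n) = t n ^+ 2 * w n ^+ 16 / 2
      - t n ^+ 4 * w n ^+ 14 / 4 + z n * t n ^+ 3 * w n ^+ 15 / 3.
    by rewrite /e /edge_h; field; rewrite gt_eqF.
  by set x := _ / _; ring.
apply: Oseq_eq (OseqM0 rO GO); near=> n.
by rewrite divfK// gt_eqF// expR_gt0.
Unshelve. all: by end_near. Qed.

Lemma tail_left : Oseq w 27 (fun n => tail n (- (w n)^-1)).
Proof.
have wO : Oseq w 0 w by exact: Oseq_base.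
have N1 : (-1 : R) ^+ 2 = 1 by rewrite sqrrN expr1n.
have H := @density_base_small (fun=> -1) 27 (Oseq_cst w _) (fun=> N1).
(* The Chernoff bound has [b] factors [1 - w ^+ 8], the monomial only [b - 1]; the extra one is
   supplied here. *)
have H' := OseqM0 (OseqB (Oseq_cst w 1) (OseqX 8 wO)) H.
apply: Oseq_le H'; near=> n.
have /andP[wn w1] : 0 < w n <= 1 by near: n.
have /andP[b0 bn] : (0 < b n <= n)%N by near: n; exact: near_threshold.
have w8 : 0 < w n ^+ 8 <= 1 by rewrite exprn_gt0//= exprn_ile1// ltW.
rewrite /tail /e.
have -> : (1 + - (w n)^-1 * w n ^+ 9) / 2 = (1 - w n ^+ 8) / 2.
  by field; rewrite gt_eqF.
have p01 : 0 <= (1 - w n ^+ 8) / 2 <= 1 by lra.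
rewrite ger0_norm; last by case/andP: (btail_ge0_le1 n (b n) p01).
apply: le_trans (ler_norm _).
apply: le_trans (btail_chernoff bn _) _; first by lra.
rewrite le_eqVlt; apply/orP; left; apply/eqP.
have -> : 2 * ((1 - w n ^+ 8) / 2) = 1 - w n ^+ 8 by field.
have -> : 2 * (1 - (1 - w n ^+ 8) / 2) = 1 + w n ^+ 8 by field.
by rewrite mulN1r opprK mulrA -exprS prednK.
Unshelve. all: by end_near. Qed.

Lemma tail_right : Oseq w 27 (fun n => tail n (w n)^-1 - 1).
Proof.
have wO : Oseq w 0 w by exact: Oseq_base.
have H := @density_base_small (fun=> 1) 27 (Oseq_cst w _) (fun=> expr1n _ 2).
have H' := OseqM0 (OseqD (Oseq_cst w 1) (OseqX 8 wO)) H.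
apply: Oseq_le H'; near=> n.
have /andP[wn w1] : 0 < w n <= 1 by near: n.
have /andP[b0 bn] : (0 < b n <= n)%N by near: n; exact: near_threshold.
have w8 : 0 < w n ^+ 8 <= 1 by rewrite exprn_gt0//= exprn_ile1// ltW.
rewrite /tail /e.
have -> : (1 + (w n)^-1 * w n ^+ 9) / 2 = (1 + w n ^+ 8) / 2.
  by field; rewrite gt_eqF.
have p01 : 0 <= (1 + w n ^+ 8) / 2 <= 1 by lra.
rewrite distrC ger0_norm; last by rewrite subr_ge0; case/andP: (btail_ge0_le1 n (b n) p01).
apply: le_trans (ler_norm _).
apply: le_trans (btail_chernoffC bn _) _; first by lra.
rewrite le_eqVlt; apply/orP; left; apply/eqP.
have -> : 2 * ((1 + w n ^+ 8) / 2) = 1 + w n ^+ 8 by field.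
have -> : 2 * (1 - (1 + w n ^+ 8) / 2) = 1 - w n ^+ 8 by field.
by rewrite mul1r mulrA -exprS prednK.
Unshelve. all: by end_near. Qed.

Lemma edge_term_small t k : Oseq w 0 t -> (forall n, t n ^+ 2 = 1) ->
  Oseq w k (fun n => e n ^+ 2 * phi (t n / w n - z n) * edge_poly (t n / w n) (z n)).
Proof.
move=> tO t2; have wO : Oseq w 0 w by exact: Oseq_base.
have ztO : Oseq w 0 (fun n => z n * t n) by Oseq0.
have zO : Oseq w 0 (fun n => expR (- z n ^+ 2 / 2)) by apply: Oseq_exp => //; Oseq0.
have QO : Oseq w 0 (fun n => w n ^+ 15 * (t n ^+ 3 / 4 - z n * t n ^+ 2 * w n / 12
   + (1 / 4 - z n ^+ 2 / 12) * t n * w n ^+ 2 + (z n - z n ^+ 3) * w n ^+ 3 / 12)).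
  by Oseq0.
have cO := Oseq_cst w (Num.sqrt (2 * pi) : R)^-1.
apply: Oseq_eq (OseqM0 (OseqM0 (OseqM0 zO cO) QO) (Oseq_gauss k ztO)); near=> n.
have /andP[wn _] : 0 < w n <= 1 by near: n.
have -> : phi (t n / w n - z n) = expR (- (w n)^-1 ^+ 2 / 2 + z n * t n / w n)
    * (expR (- z n ^+ 2 / 2) / Num.sqrt (2 * pi)).
  by rewrite phiB exprMn t2 mul1r [z n * (_ / _)]mulrA.
set E := expR (_ + _ / _); set E2 := expR _.
rewrite /e /edge_poly; field.
by rewrite !gt_eqF ?sqrt2pi_gt0.
Unshelve. all: by end_near. Qed.

Lemma edge_left : Oseq w 27 (fun n => edge_F (e n) (z n) (- (w n)^-1)).
Proof.
have [C HC] := @Phi_le_expR R.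
have zO : Oseq w 0 (fun n => expR (- z n)) by apply: Oseq_exp => //; exact: OseqN.
have N1 : (-1 : R) ^+ 2 = 1 by rewrite sqrrN expr1n.
have H := @edge_term_small (fun=> -1) 27 (Oseq_cst w _) (fun=> N1).
have P : Oseq w 27 (fun n => Phi (- (w n)^-1 - z n)).
  apply: Oseq_le (OseqM0 (OseqM0 (Oseq_cst w C) zO) (Oseq_expN 27)); near=> n.
  rewrite ger0_norm ?Phi_ge0//; apply: le_trans (HC _) _.
  by apply: le_trans (ler_norm _); rewrite -mulrA -expRD addrC.
apply: Oseq_eq (OseqD P H); near=> n.
by rewrite /edge_F mulN1r.
Unshelve. all: by end_near. Qed.

Lemma edge_right : Oseq w 27 (fun n => edge_F (e n) (z n) (w n)^-1 - 1).
Proof.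
have [C HC] := @Phi_ge_expR R.
have zO : Oseq w 0 (fun n => expR (z n)) by apply: Oseq_exp.
have H := @edge_term_small (fun=> 1) 27 (Oseq_cst w _) (fun=> expr1n _ 2).
have P : Oseq w 27 (fun n => Phi ((w n)^-1 - z n) - 1).
  apply: Oseq_le (OseqM0 (OseqM0 (Oseq_cst w C) zO) (Oseq_expN 27)); near=> n.
  rewrite distrC ger0_norm ?subr_ge0 ?Phi_le1//; apply: le_trans (HC _) _.
  by apply: le_trans (ler_norm _); rewrite -mulrA -expRD opprB addrC.
apply: Oseq_eq (OseqD P H); near=> n.
by rewrite /edge_F mul1r addrAC.
Unshelve. all: by end_near. Qed.

Lemma kap_error : Oseq w 27 (fun n => kap n - 1).
Proof.
have w1 : \forall n \near \oo, (w n)^-1 * w n = 1.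
  near=> n; have /andP[wn _] : 0 < w n <= 1 by near: n.
  by rewrite mulVf// gt_eqF.
have yO : Oseq w 0 (fun n => (w n)^-1 * w n).
  by apply: Oseq_eq (Oseq_cst w 1); near=> n; near: n.
have xO : Oseq w 0 (fun n => - (w n)^-1 * w n).
  by apply: Oseq_eq (OseqN yO); near=> n; rewrite mulNr.
pose U n := tail n (w n)^-1 - tail n (- (w n)^-1).
have UO : Oseq w 27 (fun n => U n - 1).
  by apply: Oseq_eq (OseqB tail_right tail_left); near=> n; rewrite /U; ring.
have VO : Oseq w 27 (fun n => U n / kap n - 1).
  apply: Oseq_eq (OseqD (increment_error xO yO) (OseqB edge_right edge_left)).
  by near=> n; rewrite /U; ring.
have VO' := Oseq_inv1 w01 w0 VO.
have V0 : Oseq w 0 (fun n => (U n / kap n)^-1).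
  apply: Oseq_eq (OseqD (OseqW w01 (leq0n _) VO') (Oseq_cst w 1)).
  by near=> n; rewrite subrK.
have HU : \forall n \near \oo, `|U n - 1| <= 2^-1.
  by apply: (@Oseq_near _ w) => //; exact: (OseqW w01 _ UO).
(* [U] is the binomial mass of the window, and [kap - 1 = (U - 1) * (U / kap)^-1 + ((U / kap)^-1 -
   1)]. *)
apply: Oseq_eq (OseqD (OseqM0r UO V0) VO'); near=> n.
have : `|U n - 1| <= 2^-1 by near: n.
rewrite ler_norml => Un; have U0 : 0 < U n by lra.
have kn : 0 < kap n by near: n.
by field; rewrite !gt_eqF.
Unshelve. all: by end_near. Qed.

(** Both the tail and [edge_F] are negligible at the left end [-1/w], so values are increments from
    there, and [kap] can be replaced by 1. The error [w ^+ 27] is [n^(-3/2)]. The statement on the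
    density serves the case of zero interest rate. *)
Theorem edgeworth (s : nat -> R) : Oseq w 0 s ->
  Oseq w 27 (fun n => btail n (b n) ((1 + s n * e n) / 2) - edge_F (e n) (z n) (s n)) /\
  Oseq w 27 (fun n => tail_density n (s n) - edge_f (e n) (z n) (s n)).
Proof.
move=> sO; have wO : Oseq w 0 w by exact: Oseq_base.
have k0 : Oseq w 0 kap.
  apply: Oseq_eq (OseqD (OseqW w01 (leq0n _) kap_error) (Oseq_cst w 1)).
  by near=> n; rewrite subrK.
have swO : Oseq w 0 (fun n => s n * w n) by Oseq0.
have xO : Oseq w 0 (fun n => - (w n)^-1 * w n).
  apply: Oseq_eq (Oseq_cst w (-1)); near=> n.
  have /andP[wn _] : 0 < w n <= 1 by near: n.
  by rewrite mulNr mulVf// gt_eqF.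
have F0 : Oseq w 0 (fun n => edge_F (e n) (z n) (s n)).
  have P : Oseq w 0 (fun n => Phi (s n - z n)).
    apply: Oseq_le (Oseq_cst w 1); near=> n.
    by rewrite normr1 ger0_norm ?Phi_ge0 ?Phi_le1.
  have p0 : Oseq w 0 (fun n => phi (s n - z n)) by exact: Oseq_phi.
  rewrite /edge_F /edge_poly; Oseq0.
  by apply: Oseq_eq (OseqX 9 wO); near=> n.
have f0 : Oseq w 0 (fun n => edge_f (e n) (z n) (s n)).
  have p0 : Oseq w 0 (fun n => phi (s n - z n)) by exact: Oseq_phi.
  rewrite /edge_f /edge_h /edge_c; Oseq0.
  by apply: Oseq_eq (OseqX 9 wO); near=> n.
split.
  have H1 := OseqM0 k0 (increment_error xO swO).
  have H2 := OseqM0r kap_error F0.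
  have H3 := OseqM0 k0 edge_left.
  apply: Oseq_eq (OseqD (OseqB (OseqD H1 H2) H3) tail_left); near=> n.
  have kn : 0 < kap n by near: n.
  by rewrite /tail; field; rewrite gt_eqF.
have H1 := OseqM0 k0 (OseqW w01 (isT : (27 <= 28)%N) (density_error swO)).
have H2 := OseqM0r kap_error f0.
apply: Oseq_eq (OseqD H1 H2); near=> n.
have kn : 0 < kap n by near: n.
have /andP[wn _] : 0 < w n <= 1 by near: n.
rewrite mulfK ?gt_eqF//.
by field; rewrite gt_eqF.
Unshelve. all: by end_near. Qed.

End Edgeworth.

(** * Closed form of the reflected walk *)

Section ReflectedValue.
Variable R : realType.

Fixpoint value (q : R) (g : R -> R) n (j : R) : R :=
  if n is n'.+1
  then q * value q g n' (j + 1) + (1 - q) * value q g n' (Num.max (j - 1) 0)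
  else g j.

Lemma value_complement q g n j :
  value q (fun x => 1 - g x) n j = 1 - value q g n j.
Proof. by elim: n j => //= n IH j; rewrite !IH; ring. Qed.

Lemma sum_words q g n j :
  \sum_(w : n.-tuple bool) g (level j w) * (q ^+ count id w * (1 - q) ^+ (n - count id w))
  = value q g n j.
Proof.
elim: n j => [|n IH] j /=.
  rewrite (big_pred1 [tuple]); last by move=> w; apply/esym/eqP; exact: tuple0.
  by rewrite /= !expr0 !mulr1.
rewrite (reindex (fun p : bool * n.-tuple bool => [tuple of p.1 :: p.2]))/=; last first.
  exists (fun w : n.+1.-tuple bool => (thead w, [tuple of behead w])) => [[c w]|w] _ /=.
    by congr pair; apply/val_inj.
  by rewrite [RHS]tuple_eta; apply/val_inj.
rewrite -(pair_bigA _ (fun c (w : n.-tuple bool) => g (level j (c :: w)) *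
  (q ^+ (c + count id w) * (1 - q) ^+ (n.+1 - (c + count id w)))))/=.
rewrite big_bool/= -!IH !mulr_sumr; congr (_ + _); apply: eq_bigr => w _ /=.
  by rewrite add1n exprS subSS; ring.
have cw : (count id w <= n)%N by rewrite -{2}(size_tuple w) count_size.
by rewrite add0n subSn// exprS; ring.
Qed.

(** Each word contributes exactly once, at its own terminal level and its own number of up moves;
    that [Jset] has no repetitions prevents double counting. *)
Lemma sum_Jset (q : R) (g : R -> R) n j0 :
  \sum_(j <- Jset j0 n) g j * \sum_(0 <= k < n.+1) (Lambda j0 j k n)%:R * q ^+ k * (1 - q) ^+ (n - k)
  = value q g n j0.
Proof.
rewrite -sum_words.
transitivity (\sum_(j <- Jset j0 n) \sum_(w : n.-tuple bool)
   (level j0 w == j)%:R * (g j * (q ^+ count id w * (1 - q) ^+ (n - count id w)))).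
  apply: eq_bigr => j _; rewrite mulr_sumr.
  under eq_bigr => k _.
    rewrite /Lambda -sum1_card natr_sum big_mkcond/= -mulrA mulr_suml mulr_sumr.
    over.
  rewrite exchange_big/=; apply: eq_bigr => w _.
  have cw : (count id w < n.+1)%N by rewrite ltnS -{2}(size_tuple w) count_size.
  rewrite big_mkord (bigD1 (Ordinal cw))//= inE eqxx andbT big1 ?addr0; last first.
    move=> k /negbTE kc; rewrite inE; case: ifP => [/andP[_ /eqP E]|_]; last by rewrite mul0r mulr0.
    by move: kc; rewrite -val_eqE/= E eqxx.
  by case: ifP => _; rewrite ?mul1r ?mul0r ?mulr0.
rewrite exchange_big/=; apply: eq_bigr => w _.
have wJ : level j0 w \in Jset j0 n.
  by rewrite mem_undup; apply/mapP; exists w; rewrite ?mem_enum.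
rewrite (bigD1_seq _ wJ) ?undup_uniq//= eqxx mul1r big1 ?addr0// => j.
by rewrite eq_sym => /negbTE ->; rewrite mul0r.
Qed.

End ReflectedValue.

(** * Free walks on the integers *)

Section Walk.
Variable R : realType.
Implicit Types (a c k : R) (f g : int -> R) (x y : int).

(** The weights need not add up to 1, since a change of measure rescales both. *)
Fixpoint walk a c n f x : R :=
  if n is n'.+1 then a * walk a c n' f (x + 1) + c * walk a c n' f (x - 1) else f x.

Lemma walk_ext a c n f g x : f =1 g -> walk a c n f x = walk a c n g x.
Proof. by move=> fg; elim: n x => //= n IH x; rewrite !IH. Qed.

Lemma walkD a c n k f g x :
  walk a c n (fun t => f t + k * g t) x = walk a c n f x + k * walk a c n g x.
Proof. by elim: n x => //= n IH x; rewrite !IH; ring. Qed.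

Lemma walk_shift a c n f x y :
  walk a c n f (x + y) = walk a c n (fun t => f (t + y)) x.
Proof.
elim: n x => //= n IH x; rewrite -!IH.
by congr (_ * walk _ _ _ _ _ + _ * walk _ _ _ _ _); ring.
Qed.

(** Exponential change of measure: along a path, [l ^ t] gains a factor [l] at each up step and
    [l^-1] at each down step. *)
Lemma walk_tilt a c l n f x : l != 0 ->
  walk a c n (fun t => l ^ t * f t) x = l ^ x * walk (a * l) (c / l) n f x.
Proof.
move=> l0; elim: n x => //= n IH x; rewrite !IH !expfzDr// expr1z exprN1.
by field.
Qed.

Lemma walk_scale a c k n f x : walk (k * a) (k * c) n f x = k ^+ n * walk a c n f x.
Proof.
elim: n x => [|n IH] x /=; first by rewrite expr0 mul1r.
by rewrite !IH exprS; ring.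
Qed.

Definition ind (m x : int) : R := (m <= x)%R%:R.

Lemma indD (m x y : int) : ind m (x + y) = ind (m - y) x.
Proof. by rewrite /ind lerBlDr. Qed.

(** [b] is the ceiling of [v/2], truncated at 0. For [v = n + m - x] it is the least number of up
    steps that brings the walk from [x] to [m] or above after [n] steps. *)
Definition up_half (v : int) (b : nat) : Prop :=
  match b with
  | 0%N => (v <= 0)%R
  | b'.+1 => v = (b'.+1)%:Z *+ 2 \/ v = (b'.+1)%:Z *+ 2 - 1
  end.

Lemma walk_ind p n b (m x : int) :
  up_half (n%:Z + m - x) b ->
  walk p (1 - p) n (ind m) x = btail n b p.
Proof.
elim: n b x => [|n IH] b x /=.
  case: b => [|b] /= H; rewrite /ind.
    by have -> : (m <= x)%R by lia.
  by have -> : (m <= x)%R = false by lia.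
move=> H; rewrite (IH b.-1) ?(IH b)//.
  by case: b H => [|b] /=; lia.
by case: b H => [|[|b]] /=; lia.
Qed.

(** A truncated first moment is the mean times the tail plus a covariance. The score of [p] is
    proportional to the centred number of up steps, so the covariance is [2p(1-p)] times the
    derivative of the tail in [p]. *)
Lemma walk_indM p n b (m x : int) :
  up_half (n%:Z + m - x) b ->
  walk p (1 - p) n (fun t => t%:~R * ind m t) x =
  (x%:~R + n%:R * (2 * p - 1)) * btail n b p + 2 * p * (1 - p) * btail_diff n b p.
Proof.
elim: n b x => [|n IH] b x /=.
  rewrite mul0r addr0 mulr0 addr0.
  case: b => [|b] /= H; rewrite /ind.
    by have -> : (m <= x)%R by lia.
  by have -> : (m <= x)%R = false by lia.
move=> H; rewrite (IH b.-1) ?(IH b)//.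
- by rewrite rmorphD rmorphB /= -natr1; ring.
- by case: b H => [|b] /=; lia.
- by case: b H => [|[|b]] /=; lia.
Qed.

End Walk.

(** * Survival and reflected parts of the value, and their binomial tails *)

Section ClosedForm.
Variables (R : realType) (delta E p q : R).
Let u : R := expR delta.
Hypotheses (p0 : 0 < p) (p1 : p < 1).
Hypotheses (qE : q = E * p * u) (qcE : 1 - q = E * (1 - p) / u).

Let odds := p / (1 - p).
Let lam := odds * u.
Let rho := lam * u.

Let u_gt0 : 0 < u. Proof. exact: expR_gt0. Qed.

Let odds_gt0 : 0 < odds. Proof. by rewrite divr_gt0// subr_gt0. Qed.

Let lam_gt0 : 0 < lam. Proof. by rewrite mulr_gt0. Qed.

(* Reversing time, the final level is max (j0 + X, Y) with Y the running maximum
   of the walk X; [gain] gathers the contribution of the event {Y > j0 + X},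
   as a function of the endpoint under the mirrored weights (1 - q, q). *)
Definition gain (x : int) : R :=
  if x is Posz k then \sum_(0 <= i < k) lam ^+ i - rho * \sum_(0 <= i < k - 2) lam ^+ i
  else 0.

(** This difference equation dictates the shape of [gain]: after the change of measure its two
    indicator terms become the two terms of [survival n 0]. The constant [rho] is [lam^2 / odds]. *)
Lemma gainS (x : int) :
  gain (x + 1) = gain x + lam ^ x * ind R 0 x - odds^-1 * (lam ^ x * ind R 2 x).
Proof.
case: x => k.
  rewrite -PoszD addn1 /gain big_nat_recr//=.
  case: k => [|[|k]].
  - by rewrite /ind /= !big_geq// exprnP expr0z; ring.
  - rewrite /ind /= subnn !big_nat1 [(1 - 2)%N]/=.
    by rewrite (_ : 1 - 2 = 0)%N// !big_geq// exprnP; ring.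
  - have -> : ind R 0 (Posz k.+2) = 1 by [].
    have -> : ind R 2 (Posz k.+2) = 1 by [].
    rewrite !subSS !subn0 (big_nat_recr k)//= -!exprnP !exprS.
    set S1 := \sum_(_ <= _ < _) _; set S2 := \sum_(_ <= _ < _) _.
    rewrite /rho /lam; set l := _ ^+ k; field.
    by rewrite gt_eqF.
have -> : ind R 0 (Negz k) = 0 by [].
have -> : ind R 2 (Negz k) = 0 by [].
rewrite !mulr0 addr0 subr0; case: k => [|k] //=.
by rewrite /= !big_geq// mulr0 subr0.
Qed.

Lemma walk_measure_change n f (x : int) :
  E ^+ n * (lam ^ x * walk p (1 - p) n f x)
  = walk (1 - q) q n (fun t => lam ^ t * f t) x.
Proof.
rewrite walk_tilt ?gt_eqF// qcE qE.
have -> : E * (1 - p) / u * lam = E * p.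
  by rewrite /lam /odds; field; rewrite !gt_eqF// subr_gt0.
have -> : E * p * u / lam = E * (1 - p).
  by rewrite /lam /odds; field; rewrite !gt_eqF// subr_gt0.
by rewrite walk_scale; ring.
Qed.

(* Probability under [p] that the walk started at [x] stays nonnegative. *)
Definition survival n (x : int) : R :=
  walk p (1 - p) n (ind R 0) x - odds ^ (- (x + 1)) * walk p (1 - p) n (ind R 2) (- x).

(** In the reflected term an up move of [x] is a down move of [-x]; the power of [odds] exchanges
    [p] and [1 - p] to compensate. *)
Lemma survivalS n (x : int) :
  survival n.+1 x = p * survival n (x + 1) + (1 - p) * survival n (x - 1).
Proof.
rewrite /survival /=.
have o0 : odds != 0 by rewrite gt_eqF.
have -> : odds ^ (- (x + 1 + 1)) = odds ^ (- (x + 1)) / odds.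
  by rewrite -exprN1 -expfzDr//; congr (_ ^ _); ring.
have -> : odds ^ (- (x - 1 + 1)) = odds ^ (- (x + 1)) * odds.
  by rewrite -{3}[odds]expr1z -expfzDr//; congr (_ ^ _); ring.
have -> : - (x + 1) = - x - 1 by ring.
have -> : - (x - 1) = - x + 1 by ring.
set o := odds ^ _; rewrite /odds; field.
by rewrite !gt_eqF// subr_gt0.
Qed.

Lemma survivalN1 n : survival n (-1) = 0.
Proof.
rewrite /survival addNr oppr0 expr0z mul1r.
rewrite (_ : - -1 = -1 + 2 :> int)// walk_shift.
by rewrite (@walk_ext _ _ _ _ _ (ind R 0)) ?subrr// => t; rewrite indD.
Qed.

Definition upper n (x : int) : R := walk (1 - q) q n gain (- x).

(** Starting the mirrored walk at 1 instead of 0 shifts the argument of [gain] by one, so [gainS]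
    gives the difference, with weights [lam ^ t] that [walk_measure_change] absorbs. The right-hand
    side is the value at level 0. *)
Lemma upper_boundary n : upper n (-1) = E ^+ n * survival n 0 + upper n 0.
Proof.
rewrite /upper /survival !oppr0 opprK add0r.
rewrite -[X in walk _ _ _ gain X]add0r walk_shift.
rewrite (@walk_ext _ _ _ _ _ (fun t => (gain t + 1 * (lam ^ t * ind R 0 t))
   + (- odds^-1) * (lam ^ t * ind R 2 t))); last by move=> t; rewrite gainS; ring.
rewrite !walkD -!walk_measure_change exprN1 expr0z; ring.
Qed.

(** Before the floor is hit the level keeps its fractional part [f], and changing measure turns the
    payoff into a discounted survival probability under [p]. After the hit the level is an integer,
    so [upper] does not depend on [f]. *)
Lemma value_closed n (m : nat) (f : R) : 0 <= f < 1 ->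
  value q (fun j => expR (- j * delta)) n (m%:R + f) =
  expR (- (m%:R + f) * delta) * E ^+ n * survival n m + upper n m.
Proof.
elim: n m f => [|n IH] m f f01 /=.
  rewrite expr0 mulr1 /survival /upper /=.
  have -> : ind R 0 m = 1 by [].
  have -> : ind R 2 (- m%:Z) = 0 by rewrite /ind; have -> : (2 <= - m%:Z)%R = false by lia.
  have -> : gain (- m%:Z) = 0 by case: m => [|m] //; rewrite /gain /= !big_geq// mulr0 subr0.
  by rewrite mulr0 subr0 mulr1 addr0.
have -> : m%:R + f + 1 = m.+1%:R + f by rewrite -natr1; ring.
rewrite IH// survivalS.
have upperS k : upper n.+1 k = (1 - q) * upper n (k - 1) + q * upper n (k + 1).
  by rewrite /upper /=; congr (_ * walk _ _ _ _ _ + _ * walk _ _ _ _ _); ring.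
rewrite upperS.
have -> : expR (- (m.+1%:R + f) * delta) = expR (- (m%:R + f) * delta) / u.
  by rewrite -expRB; congr expR; rewrite -natr1; ring.
have -> : (m.+1 : int) = m + 1 by rewrite -addn1 PoszD.
set X := expR _.
have Ep : E * p = q / u by rewrite qE; field; rewrite gt_eqF.
have Eq : E * (1 - p) = (1 - q) * u by rewrite qcE; field; rewrite gt_eqF.
rewrite (_ : X * E ^+ n.+1 * (p * survival n (m%:Z + 1) + (1 - p) * survival n (m%:Z - 1)) =
  X * E ^+ n * ((E * p) * survival n (m%:Z + 1) + (E * (1 - p)) * survival n (m%:Z - 1)));
  last by rewrite exprS; ring.
rewrite Ep Eq.
(* From a level in [[0, 1)] a down move lands on 0 and forgets [f]. By [survivalN1] and
   [upper_boundary], the closed form at [m = -1] takes exactly that value. *)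
case: m @X => [|m] X.
  have -> : Num.max (0%:R + f - 1) 0 = 0%:R + 0 :> R.
    by rewrite max_r; [ring|lra].
  rewrite IH ?lexx ?ltr01// (_ : 0%:Z - 1 = -1)// survivalN1 upper_boundary.
  rewrite (_ : - (0%:R + 0) * delta = 0) ?expR0; last by ring.
  by field; rewrite gt_eqF.
have -> : Num.max (m.+1%:R + f - 1) 0 = m%:R + f.
  by rewrite -natr1 max_l; [ring|have := ler0n R m; lra].
rewrite IH//.
have -> : expR (- (m%:R + f) * delta) = X * u.
  by rewrite -expRD; congr expR; rewrite -natr1; ring.
have -> : (m.+1 : int) - 1 = m by rewrite -addn1 PoszD addrK.
by field; rewrite gt_eqF.
Qed.


Lemma up_half_uphalf (k : nat) : up_half k (uphalf k).
Proof.
have := odd_double_half k; have := uphalf_half k.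
by case: (uphalf k) => [|h] /=; case: (odd k) => /=; lia.
Qed.

Lemma survival_tails n (m : nat) : (m <= n)%N -> survival n m =
  btail n (uphalf (n - m)) p - (odds ^+ m.+1)^-1 * btail n (uphalf (n + m).+2) p.
Proof.
move=> mn; rewrite /survival.
have -> : odds ^ (- (m%:Z + 1)) = (odds ^+ m.+1)^-1.
  by rewrite exprnN -addn1 PoszD.
rewrite (@walk_ind _ p n (uphalf (n - m))); last first.
  have -> : n%:Z + 0 - m%:Z = (n - m)%N :> int by lia.
  exact: up_half_uphalf.
rewrite (@walk_ind _ p n (uphalf (n + m).+2))//.
have -> : n%:Z + 2 - - m%:Z = (n + m).+2 :> int by lia.
exact: up_half_uphalf.
Qed.

Lemma gain_tail (x : int) : lam != 1 -> gain x = ind R 1 x +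
  ((1 - odds^-1) / (lam - 1)) * (lam ^ x * ind R 2 x)
  + ((rho - 1) / (lam - 1) - 1) * ind R 2 x.
Proof.
rewrite -subr_eq0 => lam1.
case: x => k; last first.
  have -> : ind R 1 (Negz k) = 0 by [].
  have -> : ind R 2 (Negz k) = 0 by [].
  by rewrite /gain; ring.
case: k => [|[|k]].
- have -> : ind R 1 0 = 0 by [].
  have -> : ind R 2 0 = 0 by [].
  by rewrite /gain !big_geq//; ring.
- have -> : ind R 1 1 = 1 by [].
  have -> : ind R 2 1 = 0 by [].
  by rewrite /gain big_nat1 big_geq// exprnP expr0z; ring.
have -> : ind R 1 (Posz k.+2) = 1 by [].
have -> : ind R 2 (Posz k.+2) = 1 by [].
have geom j : \sum_(0 <= i < j) lam ^+ i = (lam ^+ j - 1) / (lam - 1).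
  by rewrite subrX1 big_mkord mulrAC divff// mul1r.
rewrite /gain !subSS subn0 !geom -exprnP !exprS /rho /lam; field.
by rewrite lam1 gt_eqF.
Qed.

Lemma upper_tails n (m : nat) : lam != 1 -> upper n m =
  (1 - odds^-1) / (lam - 1) * ((lam ^+ m)^-1 * E ^+ n) * btail n (uphalf (n + m).+2) p
  + ((rho - 1) / (lam - 1) - 1) * btail n (uphalf (n + m).+2) (1 - q)
  + btail n (uphalf (n + m).+1) (1 - q).
Proof.
move=> lam1; rewrite /upper.
rewrite (@walk_ext _ _ _ _ _ (fun t => (ind R 1 t +
  ((1 - odds^-1) / (lam - 1)) * (lam ^ t * ind R 2 t))
  + ((rho - 1) / (lam - 1) - 1) * ind R 2 t)); last by move=> t; rewrite gain_tail.
have wq g : walk (1 - q) q n g (- m%:Z) = walk (1 - q) (1 - (1 - q)) n g (- m%:Z).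
  by rewrite subKr.
rewrite !walkD -walk_measure_change !wq.
have E2 : up_half (n%:Z + 2 - - m%:Z) (uphalf (n + m).+2).
  have -> : n%:Z + 2 - - m%:Z = (n + m).+2 :> int by lia.
  exact: up_half_uphalf.
have E1 : up_half (n%:Z + 1 - - m%:Z) (uphalf (n + m).+1).
  have -> : n%:Z + 1 - - m%:Z = (n + m).+1 :> int by lia.
  exact: up_half_uphalf.
rewrite (walk_ind _ E1) !(walk_ind _ E2) -exprnN.
ring.
Qed.

(** The geometric sums become lengths, so [gain] is affine from 2 on; its slope [1 - u] brings in
    the truncated first moment of the walk. *)
Lemma upper_tails1 n (m : nat) : lam = 1 -> upper n m =
  (1 - u) * ((n%:R * (1 - 2 * q) - m%:R) * btail n (uphalf (n + m).+2) (1 - q)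
     + 2 * (1 - q) * q * btail_diff n (uphalf (n + m).+2) (1 - q))
  + (2 * u - 1) * btail n (uphalf (n + m).+2) (1 - q)
  + btail n (uphalf (n + m).+1) (1 - q).
Proof.
move=> lam1; rewrite /upper.
have gain1 t : gain t = (ind R 1 t + (1 - u) * (t%:~R * ind R 2 t)) + (2 * u - 1) * ind R 2 t.
  case: t => k; last first.
    have -> : ind R 1 (Negz k) = 0 by [].
    have -> : ind R 2 (Negz k) = 0 by [].
    by rewrite /gain; ring.
  case: k => [|[|k]].
  - have -> : ind R 1 0 = 0 by [].
    have -> : ind R 2 0 = 0 by [].
    by rewrite /gain !big_geq//; ring.
  - have -> : ind R 1 1 = 1 by [].
    have -> : ind R 2 1 = 0 by [].
    by rewrite /gain big_nat1 big_geq// expr0; ring.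
  have -> : ind R 1 (Posz k.+2) = 1 by [].
  have -> : ind R 2 (Posz k.+2) = 1 by [].
  have geom j : \sum_(0 <= i < j) lam ^+ i = j%:R.
    by rewrite lam1 (eq_bigr (fun=> 1)) ?sumr_const_nat ?subn0// => i _; rewrite expr1n.
  by rewrite /gain !subSS subn0 !geom /rho lam1 -pmulrn -(natr1 k.+1) -(natr1 k); ring.
rewrite (walk_ext _ _ _ _ gain1) !walkD.
have wq g : walk (1 - q) q n g (- m%:Z) = walk (1 - q) (1 - (1 - q)) n g (- m%:Z).
  by rewrite subKr.
rewrite !wq.
have E2 : up_half (n%:Z + 2 - - m%:Z) (uphalf (n + m).+2).
  have -> : n%:Z + 2 - - m%:Z = (n + m).+2 :> int by lia.
  exact: up_half_uphalf.
have E1 : up_half (n%:Z + 1 - - m%:Z) (uphalf (n + m).+1).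
  have -> : n%:Z + 1 - - m%:Z = (n + m).+1 :> int by lia.
  exact: up_half_uphalf.
rewrite (walk_ind _ E1) !(walk_ind _ E2) (walk_indM _ E2).
have -> : (- m%:Z)%:~R = - m%:R :> R by rewrite intrN.
ring.
Qed.

End ClosedForm.

(** * Second order expansions *)

Section GaussianTaylor.
Variable R : realType.
Implicit Types x y K : R.

Lemma taylor2 (f f1 f2 f3 : R -> R) (K : R) :
  (forall x, is_derive x (1:R) f (f1 x)) -> (forall x, is_derive x (1:R) f1 (f2 x)) ->
  (forall x, is_derive x (1:R) f2 (f3 x)) -> (forall x, `|f3 x| <= K) ->
  forall x y, `|f (x + y) - f x - f1 x * y - f2 x * y ^+ 2 / 2| <= K * `|y| ^+ 3.
Proof.
move=> d1 d2 d3 Kf x y.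
have dshift (g g' : R -> R) t : is_derive (x + t) (1:R) g (g' (x + t)) ->
    is_derive t (1:R) (fun t => g (x + t)) (g' (x + t)).
  by move=> ?; apply: is_derive_eq; rewrite /GRing.scale/=; ring.
have D3 t := dshift f2 f3 t (d3 _).
have D2 t := dshift f1 f2 t (d2 _).
have D1 t := dshift f f1 t (d1 _).
have B2 t : `|f2 (x + t) - f2 x| <= K * `|t|.
  have := @mean_value_le R (fun t => f2 (x + t)) (fun t => f3 (x + t)) K 0 t
    (fun z _ => D3 z) (fun z _ => Kf (x + z)).
  by rewrite addr0 subr0.
have B1 t : `|f1 (x + t) - f1 x - f2 x * t| <= K * `|t| ^+ 2.
  have E s : is_derive s (1:R) (fun t => f1 (x + t) - f1 x - f2 x * t) (f2 (x + s) - f2 x).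
    have ? := D2 s; apply: is_derive_eq.
    by rewrite /GRing.scale/=; ring.
  have B s : (0 <= s <= t) || (t <= s <= 0) -> `|f2 (x + s) - f2 x| <= K * `|t|.
    move=> st; apply: le_trans (B2 _) _; rewrite ler_wpM2l ?norm_between0//.
    exact: le_trans (Kf 0).
  have := mean_value_le (fun s _ => E s) B.
  by rewrite addr0 mulr0 subrr !subr0 -mulrA -expr2.
have E s : is_derive s (1:R) (fun t => f (x + t) - f x - f1 x * t - f2 x * t ^+ 2 / 2)
    (f1 (x + s) - f1 x - f2 x * s).
  have ? := D1 s; apply: is_derive_eq.
  by rewrite /GRing.scale/=; field.
have B s : (0 <= s <= y) || (y <= s <= 0) -> `|f1 (x + s) - f1 x - f2 x * s| <= K * `|y| ^+ 2.
  move=> st; apply: le_trans (B1 _) _.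
  rewrite ler_wpM2l ?lerXn2r ?nnegrE ?norm_between0//; exact: le_trans (Kf 0).
have := mean_value_le (fun s _ => E s) B.
by rewrite addr0 mulr0 expr0n /= mulr0 mul0r subrr !subr0 -[K * _ * _]mulrA -exprSr.
Qed.

(** With [y = x^2/2], [9 * exp y >= 9 * (1 + y^2/2) >= 1 + x^4]. This dominates the third
    derivatives of [Phi] and, up to a factor 3, of [phi]. *)
Lemma phi_moment x : (1 + x ^+ 4) * phi x <= 9 / Num.sqrt (2 * pi).
Proof.
rewrite /phi mulrA ler_wpM2r ?invr_ge0 ?sqrtr_ge0//.
have E0 : expR (- x ^+ 2 / 2) = (expR (x ^+ 2 / 2))^-1 by rewrite mulNr expRN.
rewrite E0 ler_pdivrMr ?expR_gt0//.
have x2 : 0 <= x ^+ 2 / 2 by rewrite divr_ge0 ?sqr_ge0.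
have := expR_ge1Dxn 1 x2; rewrite !factS fact0 => H.
have -> : x ^+ 4 = (x ^+ 2) ^+ 2 by rewrite -exprM.
move: H; rewrite expr_div_n.
by have := sqr_ge0 (x ^+ 2); lra.
Qed.

Lemma Phi_taylor : exists K : R, forall x y,
  `|Phi (x + y) - Phi x - phi x * y - (- x * phi x) * y ^+ 2 / 2| <= K * `|y| ^+ 3.
Proof.
exists (9 / Num.sqrt (2 * pi)).
have D3 x : is_derive x (1:R) (fun x => - x * phi x) ((x ^+ 2 - 1) * phi x).
  have ? := is_derive_phi x; apply: is_derive_eq.
  by rewrite /GRing.scale/=; ring.
have B x : `|(x ^+ 2 - 1) * phi x| <= 9 / Num.sqrt (2 * pi).
  apply: le_trans (phi_moment x); rewrite normrM (@ger0_norm _ (phi x)) ?phi_ge0//.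
  rewrite ler_wpM2r ?phi_ge0// ler_norml.
  have -> : x ^+ 4 = (x ^+ 2) ^+ 2 by rewrite -exprM.
  have := sqr_ge0 x; have := sqr_ge0 (x ^+ 2 - 1).
  by move=> *; apply/andP; split; nra.
exact: (taylor2 (@is_derive_Phi R) (@is_derive_phi R) D3 B).
Qed.

Lemma phi_taylor : exists K : R, forall x y,
  `|phi (x + y) - phi x - (- x * phi x) * y - ((x ^+ 2 - 1) * phi x) * y ^+ 2 / 2|
  <= K * `|y| ^+ 3.
Proof.
exists (3 * (9 / Num.sqrt (2 * pi))).
have D2 x : is_derive x (1:R) (fun x => - x * phi x) ((x ^+ 2 - 1) * phi x).
  have ? := is_derive_phi x; apply: is_derive_eq.
  by rewrite /GRing.scale/=; ring.
have D3 x : is_derive x (1:R) (fun x => (x ^+ 2 - 1) * phi x) ((3 * x - x ^+ 3) * phi x).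
  have ? := is_derive_phi x; apply: is_derive_eq.
  by rewrite /GRing.scale/=; ring.
have B x : `|(3 * x - x ^+ 3) * phi x| <= 3 * (9 / Num.sqrt (2 * pi)).
  have H := phi_moment x.
  apply: le_trans (_ : 3 * ((1 + x ^+ 4) * phi x) <= _); last by rewrite ler_wpM2l.
  rewrite normrM (@ger0_norm _ (phi x)) ?phi_ge0// mulrA.
  rewrite ler_wpM2r ?phi_ge0// ler_norml.
  have -> : x ^+ 4 = (x ^+ 2) ^+ 2 by rewrite -exprM.
  have -> : x ^+ 3 = x * x ^+ 2 by rewrite exprS.
  have := sqr_ge0 x; have := sqr_ge0 (x ^+ 2 - 1).
  have := sqr_ge0 (x - 1); have := sqr_ge0 (x + 1).
  have := sqr_ge0 (x ^+ 2 - x); have := sqr_ge0 (x ^+ 2 + x).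
  by move=> *; apply/andP; split; nra.
exact: (taylor2 (@is_derive_phi R) D2 D3 B).
Qed.

End GaussianTaylor.

(** * Arithmetic of second order expansions *)

Section Expansions.
Variable R : realType.
Variable e : nat -> R.
Hypotheses (e01 : small e) (e0 : vanishing e).
Implicit Types F G a b c : nat -> R.

(** The coefficients are bounded sequences, not numbers, because the fractional part and the parity
    of the threshold enter them without converging. *)
Definition expands F a b c : Prop :=
  [/\ Oseq e 0 a, Oseq e 0 b, Oseq e 0 c &
      Oseq e 3 (fun n => F n - (a n + b n * e n + c n * e n ^+ 2))].

Let eO : Oseq e 0 e := Oseq_base e01.

Lemma expands_eq F G a b c a' b' c' :
  (\forall n \near \oo, F n = G n) -> (forall n, a n = a' n) -> (forall n, b n = b' n) ->
  (forall n, c n = c' n) -> expands G a' b' c' -> expands F a b c.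
Proof.
move=> FG /funext -> /funext -> /funext -> [? ? ? H]; split => //.
by apply: Oseq_eq H; apply: filterS FG => n ->.
Qed.

Lemma expands_ext F G a b c a' b' c' :
  (forall n, F n = G n) -> (forall n, a n = a' n) -> (forall n, b n = b' n) ->
  (forall n, c n = c' n) -> expands G a' b' c' -> expands F a b c.
Proof. by move=> FG; apply: expands_eq; near=> n. Unshelve. all: by end_near. Qed.

Lemma expands_poly a b c : Oseq e 0 a -> Oseq e 0 b -> Oseq e 0 c ->
  expands (fun n => a n + b n * e n + c n * e n ^+ 2) a b c.
Proof.
move=> ? ? ?; split => //; apply: (@OseqW _ _ 3) => //.
by exists 0; near=> n; rewrite subrr normr0 mul0r.
Unshelve. all: by end_near. Qed.

Lemma expands_cst (k : R) : expands (fun=> k) (fun=> k) (fun=> 0) (fun=> 0).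
Proof.
apply: expands_eq (expands_poly (Oseq_cst e k) (Oseq_cst e 0) (Oseq_cst e 0)) => //.
by near=> n; ring.
Unshelve. all: by end_near. Qed.

Lemma expandsD F G a b c a' b' c' : expands F a b c -> expands G a' b' c' ->
  expands (fun n => F n + G n) (fun n => a n + a' n) (fun n => b n + b' n) (fun n => c n + c' n).
Proof.
move=> [a0 b0 c0 H] [a0' b0' c0' H']; split; try exact: OseqD.
by apply: Oseq_eq (OseqD H H'); near=> n; ring.
Unshelve. all: by end_near. Qed.

Lemma expandsZ k F a b c : expands F a b c ->
  expands (fun n => k * F n) (fun n => k * a n) (fun n => k * b n) (fun n => k * c n).
Proof.
have k0 := Oseq_cst e k.
move=> [a0 b0 c0 H]; split; try exact: OseqM0.
by apply: Oseq_eq (OseqM0 k0 H); near=> n; ring.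
Unshelve. all: by end_near. Qed.

Lemma expands_bounded F a b c : expands F a b c -> Oseq e 0 F.
Proof.
move=> [a0 b0 c0 /(OseqW e01 (leq0n 3)) H].
have P : Oseq e 0 (fun n => a n + b n * e n + c n * e n ^+ 2) by Oseq0.
by apply: Oseq_eq (OseqD H P); near=> n; rewrite subrK.
Unshelve. all: by end_near. Qed.

Lemma expandsM F G a b c a' b' c' : expands F a b c -> expands G a' b' c' ->
  expands (fun n => F n * G n) (fun n => a n * a' n) (fun n => a n * b' n + b n * a' n)
    (fun n => a n * c' n + b n * b' n + c n * a' n).
Proof.
move=> HF HG; have FO := expands_bounded HF.
case: HF HG => [a0 b0 c0 H] [a0' b0' c0' H']; split; try by Oseq0.
have PO : Oseq e 0 (fun n => a' n + b' n * e n + c' n * e n ^+ 2) by Oseq0.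
have rO : Oseq e 0 (fun n => b n * c' n + c n * b' n + c n * c' n * e n) by Oseq0.
apply: Oseq_eq (OseqD (OseqD (OseqM0 FO H') (OseqM0r H PO)) (Oseq_wM 3 e01 rO)).
by near=> n; ring.
Unshelve. all: by end_near. Qed.

Lemma Oseq_split1 F a b c : expands F a b c ->
  Oseq e 1 (fun n => F n - a n) /\
  Oseq e 2 (fun n => F n - a n - b n * e n).
Proof.
move=> [a0 b0 c0 H].
have H2 : Oseq e 2 (fun n => F n - a n - b n * e n).
  apply: Oseq_eq (OseqD (OseqW e01 (isT : (2 <= 3)%N) H) (Oseq_wM 2 e01 c0)).
  by near=> n; ring.
split => //.
apply: Oseq_eq (OseqD (OseqW e01 (isT : (1 <= 2)%N) H2) (Oseq_wM 1 e01 b0)).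
by near=> n; rewrite expr1; ring.
Unshelve. all: by end_near. Qed.

Lemma expands_taylor (f : R -> R) (f0 f1 f2 K : nat -> R) F a b c :
  (forall n y, `|y| <= 1 ->
    `|f (a n + y) - f0 n - f1 n * y - f2 n * y ^+ 2 / 2| <= K n * `|y| ^+ 3) ->
  Oseq e 0 K -> Oseq e 0 f0 -> Oseq e 0 f1 -> Oseq e 0 f2 -> expands F a b c ->
  expands (fun n => f (F n)) f0 (fun n => f1 n * b n)
    (fun n => f1 n * c n + f2 n * b n ^+ 2 / 2).
Proof.
move=> HK KO f0O f1O f2O HF; have [H1 H2] := Oseq_split1 HF.
case: HF => [a0 b0 c0 H].
split => //; [by Oseq0|by Oseq0|].
have y1 := @Oseq_near _ _ _ 1 e01 e0 H1 ltr01.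
pose y n := F n - a n.
have T : Oseq e 3 (fun n => f (a n + y n) - f0 n - f1 n * y n - f2 n * y n ^+ 2 / 2).
  apply: (@Oseq_le _ _ _ _ (fun n => K n * (y n * y n * y n))); last first.
    by apply: OseqM0 => //; exact: OseqM (OseqM H1 H1) H1.
  near=> n; apply: le_trans (HK n _ _) _; first by near: n.
  rewrite normrM -[`|y n| ^+ 3]normrX.
  apply: le_trans (ler_wpM2r _ (ler_norm (K n))) _ => //.
  by rewrite ler_wpM2l// le_eqVlt; apply/orP; left; apply/eqP; congr `|_|; ring.
have sq : Oseq e 3 (fun n => (f2 n / 2) * ((y n - b n * e n) * (y n + b n * e n))).
  apply: OseqM0; first by Oseq0.
  apply: (@OseqM _ _ 2 1) => //; apply: OseqD => //.
  by apply: Oseq_eq (Oseq_wM 1 e01 b0); near=> n; rewrite expr1 mulrC.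
apply: Oseq_eq (OseqD T (OseqD (OseqM0 f1O H) sq)); near=> n.
by rewrite (_ : a n + y n = F n); [rewrite /y; field|rewrite /y; ring].
Unshelve. all: by end_near. Qed.

Lemma expands_exp F a b c : expands F a b c ->
  expands (fun n => expR (F n)) (fun n => expR (a n)) (fun n => expR (a n) * b n)
    (fun n => expR (a n) * c n + expR (a n) * b n ^+ 2 / 2).
Proof.
move=> HF; have [a0 _ _ _] := HF.
have aO : Oseq e 0 (fun n => expR (a n)) by exact: Oseq_exp.
have KO : Oseq e 0 (fun n => expR (a n) * expR 1).
  by apply: OseqM0 => //; exact: Oseq_cst.
apply: (expands_taylor (K := fun n => expR (a n) * expR 1) _ KO aO aO aO HF).
move=> n y y1; have := exp_taylor 3 y1.
rewrite /exp_poly !big_ord_recl big_ord0/= /bump/= !expr0 !expr1 !fact0 !factS fact0.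
move=> H; rewrite -[leRHS]mulrA.
apply: le_trans (_ : expR (a n) * `|expR y - (1 + y + y ^+ 2 / 2)| <= _); last first.
  rewrite ler_wpM2l ?expR_ge0//; apply: le_trans H.
  by rewrite le_eqVlt; apply/orP; left; apply/eqP; congr `|_|; field.
rewrite [leRHS](_ : _ = `|expR (a n) * (expR y - (1 + y + y ^+ 2 / 2))|); last first.
  by rewrite normrM (ger0_norm (expR_ge0 _)).
rewrite expRD.
by rewrite le_eqVlt; apply/orP; left; apply/eqP; congr `|_|; field.
Qed.

Lemma Oseq_Phi (x : nat -> R) : Oseq e 0 (fun n => Phi (x n)).
Proof.
apply: Oseq_le (Oseq_cst e 1); near=> n.
by rewrite normr1 ger0_norm ?Phi_ge0 ?Phi_le1.
Unshelve. all: by end_near. Qed.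

Lemma expands_Phi F a b c : expands F a b c ->
  expands (fun n => Phi (F n)) (fun n => Phi (a n)) (fun n => phi (a n) * b n)
    (fun n => phi (a n) * c n + - a n * phi (a n) * b n ^+ 2 / 2).
Proof.
move=> HF; have [aO _ _ _] := HF; have [K HK] := @Phi_taylor R.
have pO : Oseq e 0 (fun n => phi (a n)) by exact: Oseq_phi.
have dO : Oseq e 0 (fun n => - a n * phi (a n)) by Oseq0.
exact: (expands_taylor (fun n y _ => HK (a n) y) (Oseq_cst e K) (Oseq_Phi a) pO dO HF).
Qed.

Lemma expands_phi F a b c : expands F a b c ->
  expands (fun n => phi (F n)) (fun n => phi (a n)) (fun n => - a n * phi (a n) * b n)
    (fun n => - a n * phi (a n) * c n + (a n ^+ 2 - 1) * phi (a n) * b n ^+ 2 / 2).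
Proof.
move=> HF; have [aO _ _ _] := HF; have [K HK] := @phi_taylor R.
have pO : Oseq e 0 (fun n => phi (a n)) by exact: Oseq_phi.
have dO : Oseq e 0 (fun n => - a n * phi (a n)) by Oseq0.
have ddO : Oseq e 0 (fun n => (a n ^+ 2 - 1) * phi (a n)) by Oseq0.
exact: (expands_taylor (fun n y _ => HK (a n) y) (Oseq_cst e K) pO dO ddO HF).
Qed.

Lemma expands_inv F (a : R) b c : a != 0 -> expands F (fun=> a) b c ->
  expands (fun n => (F n)^-1) (fun=> a^-1) (fun n => - b n / a ^+ 2)
    (fun n => b n ^+ 2 / a ^+ 3 - c n / a ^+ 2).
Proof.
move=> a0 HF; have [_ bO cO H] := HF.
have [H1 _] := Oseq_split1 HF.
have a2 : 0 < `|a| / 2 by rewrite divr_gt0 ?normr_gt0.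
have near_a := @Oseq_near _ _ _ _ e01 e0 H1 a2.
have FVO : Oseq e 0 (fun n => (F n)^-1).
  exists (`|a| / 2)^-1; near=> n; rewrite expr0 mulr1 normfV.
  have Fa : `|F n - a| <= `|a| / 2 by near: n.
  rewrite lef_pV2 ?posrE//; last first.
    by have := ler_distD (F n) a 0; rewrite !subr0 distrC; lra.
  by have := ler_distD (F n) a 0; rewrite !subr0 distrC; lra.
pose P n := a^-1 + (- b n / a ^+ 2) * e n + (b n ^+ 2 / a ^+ 3 - c n / a ^+ 2) * e n ^+ 2.
split; [exact: Oseq_cst|by Oseq0|by Oseq0|].
have PO : Oseq e 0 P by rewrite /P; Oseq0.
pose r n := (b n * c n / a ^+ 2) *+ 2 - b n ^+ 3 / a ^+ 3 + (c n ^+ 2 / a ^+ 2 - c n * b n ^+ 2 / a ^+ 3) * e n.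
have rO : Oseq e 0 r.
  rewrite /r; apply: OseqD; last by Oseq0.
  apply: OseqD; last by Oseq0.
  by apply: Oseq_eq (_ : Oseq e 0 (fun n => 2 * (b n * c n / a ^+ 2))); [near=> n; ring|Oseq0].
have D : Oseq e 3 (fun n => (F n)^-1 * (e n ^+ 3 * r n - (F n - (a + b n * e n + c n * e n ^+ 2)) * P n)).
  apply: OseqM0 => //; apply: OseqB; first exact: Oseq_wM.
  exact: OseqM0r.
apply: Oseq_eq D; near=> n.
have Fn : F n != 0.
  have Fa : `|F n - a| <= `|a| / 2 by near: n.
  apply/eqP => F0; move: Fa; rewrite F0 sub0r normrN; have := normr_gt0 a; lra.
by rewrite /P /r; field; rewrite Fn a0.
Unshelve. all: by end_near. Qed.

End Expansions.

Section LeadingOrder.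
Variables (R : realType) (e : nat -> R).
Hypothesis (e01 : small e) (e0 : vanishing e).
Implicit Types (F G a b : nat -> R).

(** First order accuracy is all that is needed of a factor standing behind [e ^+ 2], such as the
    Edgeworth correction. *)
Definition lead F a : Prop := Oseq e 0 a /\ Oseq e 1 (fun n => F n - a n).

Lemma lead_bounded F a : lead F a -> Oseq e 0 F.
Proof.
move=> [aO /(OseqW e01 (leq0n 1)) H]; apply: Oseq_eq (OseqD H aO).
by near=> n; rewrite subrK.
Unshelve. all: by end_near. Qed.

Lemma lead_cst (k : R) : lead (fun=> k) (fun=> k).
Proof.
split; first exact: Oseq_cst.
by exists 0; near=> n; rewrite subrr normr0 mul0r.
Unshelve. all: by end_near. Qed.

Lemma leadD F G a b : lead F a -> lead G b ->
  lead (fun n => F n + G n) (fun n => a n + b n).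
Proof.
move=> [aO H] [bO H']; split; first exact: OseqD.
by apply: Oseq_eq (OseqD H H'); near=> n; ring.
Unshelve. all: by end_near. Qed.

Lemma leadM F G a b : lead F a -> lead G b ->
  lead (fun n => F n * G n) (fun n => a n * b n).
Proof.
move=> [aO H] G'; have GO := lead_bounded G'; case: G' => bO H'.
split; first exact: OseqM0.
by apply: Oseq_eq (OseqD (OseqM0r H GO) (OseqM0 aO H')); near=> n; ring.
Unshelve. all: by end_near. Qed.

Lemma leadN F a : lead F a -> lead (fun n => - F n) (fun n => - a n).
Proof.
move=> [aO H]; split; first exact: OseqN.
by apply: Oseq_eq (OseqN H); near=> n; ring.
Unshelve. all: by end_near. Qed.

Lemma leadX F a k : lead F a -> lead (fun n => F n ^+ k) (fun n => a n ^+ k).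
Proof.
move=> H; elim: k => [|k IH]; first exact: lead_cst.
have [aO H'] := leadM H IH; split; first by apply: Oseq_eq aO; near=> n; rewrite exprS.
by apply: Oseq_eq H'; near=> n; rewrite !exprS.
Unshelve. all: by end_near. Qed.

Lemma expands_lead F a b c : expands e F a b c -> lead F a.
Proof. by move=> H; have [H1 _] := Oseq_split1 e01 H; case: H. Qed.

Lemma expands_sqrM F a : lead F a ->
  expands e (fun n => e n ^+ 2 * F n) (fun=> 0) (fun=> 0) a.
Proof.
move=> [aO H]; split => //; try exact: Oseq_cst.
apply: Oseq_eq (OseqM (OseqXw 2 e01) H); near=> n; ring.
Unshelve. all: by end_near. Qed.

End LeadingOrder.

Ltac lead_tac :=
  match goal with
  | |- lead _ (fun n => _ + _) _ => apply: leadD => //; lead_tac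
  | |- lead _ (fun n => - _) _ => apply: leadN => //; lead_tac
  | |- lead _ (fun n => _ * _) _ => apply: leadM => //; lead_tac
  | |- lead _ (fun n => _ ^+ _) _ => apply: leadX => //; lead_tac
  | |- lead _ (fun=> _) _ => exact: lead_cst
  | _ => eassumption
  end.

(** * Binomial tails on the scale of the inverse square root of [n] *)

Section SquareRootScale.
Variable R : realType.

Definition rsqrt (n : nat) : R := (Num.sqrt n%:R)^-1.
Local Notation e := rsqrt.

Lemma rsqrt_root18 : \forall n \near \oo, e n = root18 R n ^+ 9.
Proof. by exists 1%N => // n /= n0; rewrite root18_sqrt. Qed.

Lemma rsqrt_gt0 n : (0 < n)%N -> 0 < e n.
Proof. by move=> n0; rewrite invr_gt0 sqrtr_gt0 ltr0n. Qed.

Lemma rsqrt_sqr n : e n ^+ 2 = n%:R^-1.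
Proof. by rewrite exprVn sqr_sqrtr. Qed.

Lemma small_rsqrt : small e.
Proof.
exists 1%N => // n /= n0; rewrite rsqrt_gt0//=.
rewrite invf_le1 ?sqrtr_gt0 ?ltr0n// -[leLHS]sqrtr1.
by rewrite ler_wsqrtr// ler1n.
Qed.

Lemma vanishing_rsqrt : vanishing e.
Proof.
move=> d d0; near=> n.
have n0 : (0 < n)%N by near: n; exists 1%N.
rewrite -(@ler_pXn2r _ 2)// ?nnegrE ?(ltW (rsqrt_gt0 _)) ?(ltW d0)//.
rewrite rsqrt_sqr -[leRHS]invrK lef_pV2 ?posrE ?invr_gt0 ?exprn_gt0 ?ltr0n//.
by near: n; exact: nbhs_infty_ger.
Unshelve. all: by end_near. Qed.

Let e01 := small_rsqrt.
Let e0 := vanishing_rsqrt.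

Lemma Oseq0_base (v w : nat -> R) F : Oseq v 0 F -> Oseq w 0 F.
Proof. by move=> [C HC]; exists C; apply: filterS HC => n; rewrite !expr0. Qed.

Lemma Oseq_divn (k j : nat) F : Oseq e (k + j) F -> Oseq e k (fun n => F n / e n ^+ j).
Proof.
move=> HF; apply: Oseq_eq (Oseq_wM k e01 (Oseq_divX e01 HF)); near=> n.
have en : e n != 0 by rewrite gt_eqF// rsqrt_gt0//; near: n; exists 1%N.
have ek : e n ^+ k != 0 by rewrite expf_neq0.
have ej : e n ^+ j != 0 by rewrite expf_neq0.
by rewrite exprD; field; rewrite ek ej.
Unshelve. all: by end_near. Qed.

Lemma near_rsqrt : \forall n \near \oo, 0 < e n.
Proof. by exists 1%N => // n /= n0; exact: rsqrt_gt0. Qed.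

Section Tails.
Variables (b : nat -> nat) (s z : nat -> R).
Hypothesis bz : \forall n \near \oo, 2 * (b n)%:R - n%:R - 1 = z n / e n.
Variables (s0 s2 z0 : R) (z1 : nat -> R).
Hypothesis sE : expands e s (fun=> s0) (fun=> 0) (fun=> s2).
Hypothesis zE : expands e z (fun=> z0) z1 (fun=> 0).

Let x0 := s0 - z0.

Let zO : Oseq e 0 z := expands_bounded e01 zE.
Let sO : Oseq e 0 s := expands_bounded e01 sE.

Let bz' : \forall n \near \oo, 2 * (b n)%:R - n%:R - 1 = z n * Num.sqrt n%:R.
Proof. by apply: filterS bz => n; rewrite invrK. Qed.

Let xE : expands e (fun n => s n - z n) (fun=> x0) (fun n => - z1 n) (fun=> s2).
Proof.
by apply: (expands_ext _ _ _ _ (expandsD sE (expandsZ (-1) zE))) => n; rewrite /x0; ring.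
Qed.

Let sL : lead e s (fun=> s0) := expands_lead e01 sE.
Let zL : lead e z (fun=> z0) := expands_lead e01 zE.
Let phiE := expands_phi e01 e0 xE.
Let phiL : lead e (fun n => phi (s n - z n)) (fun=> phi x0) := expands_lead e01 phiE.

(** The argument is [s - z = x0 - z1 * e + s2 * e ^+ 2] up to [O(e ^+ 3)], since the drift has no
    first order term and the threshold no second order term. The correction [edge_poly] enters with
    its leading value only. *)
Lemma expands_btail :
  expands e (fun n => btail n (b n) ((1 + s n * e n) / 2))
    (fun=> Phi x0) (fun n => - (phi x0 * z1 n))
    (fun n => phi x0 * (s2 - x0 * z1 n ^+ 2 / 2 + edge_poly s0 z0)).
Proof.
have [H _] := edgeworth bz' (Oseq0_base _ zO) (Oseq0_base _ sO).
have QL : lead e (fun n => phi (s n - z n) * edge_poly (s n) (z n))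
                 (fun=> phi x0 * edge_poly s0 z0).
  by apply: leadM => //; rewrite /edge_poly; lead_tac.
have [_ _ _ FE] := expandsD (expands_Phi e01 e0 xE) (expands_sqrM e01 QL).
have pO : Oseq e 0 (fun=> phi x0) := Oseq_cst _ _.
have [_ z1O _ _] := zE.
split; [exact: Oseq_Phi|by Oseq0|by Oseq0; exact: Oseq_cst|].
apply: Oseq_eq (OseqD (@Oseq_base_change _ _ _ 9 3 _ rsqrt_root18 H) FE); near=> n.
have En : e n = root18 R n ^+ 9 by near: n; exact: rsqrt_root18.
by rewrite En /edge_F; field.
Unshelve. all: by end_near. Qed.

Lemma expands_tail_density :
  expands e (fun n => tail_density b n (s n))
    (fun=> phi x0) (fun n => x0 * phi x0 * z1 n)
    (fun n => phi x0 * (- x0 * s2 + (x0 ^+ 2 - 1) * z1 n ^+ 2 / 2 + edge_c z0 + edge_h s0 z0)).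
Proof.
have [_ H] := edgeworth bz' (Oseq0_base _ zO) (Oseq0_base _ sO).
have QL : lead e (fun n => phi (s n - z n) * (edge_c (z n) + edge_h (s n) (z n)))
                 (fun=> phi x0 * (edge_c z0 + edge_h s0 z0)).
  by apply: leadM => //; rewrite /edge_c /edge_h; lead_tac.
have [_ _ _ FE] := expandsD phiE (expands_sqrM e01 QL).
have pO : Oseq e 0 (fun=> phi x0) := Oseq_cst _ _.
have [_ z1O _ _] := zE.
split; [exact: Oseq_cst|by Oseq0; exact: Oseq_cst|by Oseq0; exact: Oseq_cst|].
apply: Oseq_eq (OseqD (@Oseq_base_change _ _ _ 9 3 _ rsqrt_root18 H) FE); near=> n.
have En : e n = root18 R n ^+ 9 by near: n; exact: rsqrt_root18.
by rewrite En /edge_f; field.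
Unshelve. all: by end_near. Qed.

End Tails.

End SquareRootScale.

(** * Expansions of the one-step data *)

Section ElementaryExpansions.
Variable R : realType.
Local Notation e := (rsqrt R).
Let e01 : small e := small_rsqrt R.
Let e0 : vanishing e := @vanishing_rsqrt R.
Let eO : Oseq e 0 e := Oseq_base e01.

Lemma exp_remainder (k : R) (j m : nat) :
  Oseq e (j.+1 * m) (fun n => expR (k * e n ^+ j.+1) - exp_poly m (k * e n ^+ j.+1)).
Proof.
pose y n := k * e n ^+ j.+1.
have yO : Oseq e 1 y.
  apply: (@OseqW _ _ j.+1) => //; apply: OseqM0; [exact: Oseq_cst|exact: OseqXw].
have y1 := @Oseq_near _ _ _ 1 e01 e0 yO ltr01.
apply: (@Oseq_le _ _ _ _ (fun n => expR 1 * k ^+ m * e n ^+ (j.+1 * m))); last first.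
  by apply: OseqM0; [exact: Oseq_cst|exact: OseqXw].
near=> n; have yn : `|y n| <= 1 by near: n.
apply: le_trans (exp_taylor m yn) _.
rewrite [leRHS](_ : _ = `|expR 1 * y n ^+ m|); last first.
  by congr `|_|; rewrite -mulrA exprM -exprMn.
by rewrite [leRHS]normrM [`|y n ^+ m|]normrX (@ger0_norm _ (expR 1)) ?expR_ge0.
Unshelve. all: by end_near. Qed.

Lemma exp_poly3E (y : R) : exp_poly 3 y = 1 + y + y ^+ 2 / 2.
Proof. by rewrite /exp_poly !big_ord_recl big_ord0 /= /bump /= !factS fact0 !exprS; field. Qed.
Lemma exp_poly4E (y : R) : exp_poly 4 y = 1 + y + y ^+ 2 / 2 + y ^+ 3 / 6.
Proof. by rewrite /exp_poly !big_ord_recl big_ord0 /= /bump /= !factS fact0 !exprS; field. Qed.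
Lemma exp_poly5E (y : R) : exp_poly 5 y = 1 + y + y ^+ 2 / 2 + y ^+ 3 / 6 + y ^+ 4 / 24.
Proof. by rewrite /exp_poly !big_ord_recl big_ord0 /= /bump /= !factS fact0 !exprS; field. Qed.

Variable c : R.
Let U n := expR (c * e n).
Let D n := expR (- (c * e n)).

Lemma exp_remainder1 (k : R) m : Oseq e m (fun n => expR (k * e n) - exp_poly m (k * e n)).
Proof.
have := exp_remainder k 0 m; rewrite mul1n; apply: Oseq_eq; near=> n.
by rewrite expr1.
Unshelve. all: by end_near. Qed.

Let DE n : D n = expR (- c * e n). Proof. by rewrite /D mulNr. Qed.

(** The odd powers of [c * e] cancel between [U] and [D]. Remainders of order five are needed
    because two orders are lost to the division. *)
Lemma expands_second_difference (x : R) :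
  expands e (fun n => (2 * expR (x * e n ^+ 2) - U n - D n) / e n ^+ 2)
    (fun=> 2 * x - c ^+ 2) (fun=> 0) (fun=> x ^+ 2 - c ^+ 4 / 12).
Proof.
split; try exact: Oseq_cst.
have H1 := OseqW e01 (isT : (5 <= 6)%N) (exp_remainder x 1 3).
have H2 := exp_remainder1 c 5.
have H3 := exp_remainder1 (- c) 5.
apply: Oseq_eq (@Oseq_divn R 3 2 _ (OseqB (OseqB (OseqM0 (Oseq_cst e 2) H1) H2) H3)); near=> n.
have en : 0 < e n by near: n; exact: near_rsqrt.
rewrite DE exp_poly3E !exp_poly5E /U; field.
by rewrite gt_eqF.
Unshelve. all: by end_near. Qed.

Lemma expands_first_difference :
  expands e (fun n => (U n - D n) / e n)
    (fun=> 2 * c) (fun=> 0) (fun=> c ^+ 3 / 3).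
Proof.
split; try exact: Oseq_cst.
apply: Oseq_eq (@Oseq_divn R 3 1 _ (OseqB (exp_remainder1 c 4) (exp_remainder1 (- c) 4))); near=> n.
have en : 0 < e n by near: n; exact: near_rsqrt.
rewrite DE !exp_poly4E /U; field.
by rewrite gt_eqF.
Unshelve. all: by end_near. Qed.

Lemma expands_oneBexp :
  expands e (fun n => (1 - U n) / e n)
    (fun=> - c) (fun=> - c ^+ 2 / 2) (fun=> - c ^+ 3 / 6).
Proof.
split; try exact: Oseq_cst.
apply: Oseq_eq (@Oseq_divn R 3 1 _ (OseqN (exp_remainder1 c 4))); near=> n.
have en : 0 < e n by near: n; exact: near_rsqrt.
rewrite exp_poly4E /U; field.
by rewrite gt_eqF.
Unshelve. all: by end_near. Qed.

Lemma expands_discount (x : R) :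
  expands e (fun n => (1 - expR (- x * e n ^+ 2)) / e n ^+ 2)
    (fun=> x) (fun=> 0) (fun=> - x ^+ 2 / 2).
Proof.
split; try exact: Oseq_cst.
have H1 := OseqW e01 (isT : (5 <= 6)%N) (exp_remainder (- x) 1 3).
apply: Oseq_eq (@Oseq_divn R 3 2 _ (OseqN H1)); near=> n.
have en : 0 < e n by near: n; exact: near_rsqrt.
rewrite exp_poly3E; field.
by rewrite gt_eqF.
Unshelve. all: by end_near. Qed.

Lemma expands_exp_e (b : nat -> R) : Oseq e 0 b ->
  expands e (fun n => expR (b n * e n)) (fun=> 1) b (fun n => b n ^+ 2 / 2).
Proof.
move=> bO; have P := expands_poly e01 (Oseq_cst e 0) bO (Oseq_cst e 0).
have := expands_exp e01 e0 P.
by apply: expands_ext => n; rewrite ?expR0 ?mul1r; [congr expR|..]; ring.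
Qed.

Lemma expands_exp_e2 (x : R) :
  expands e (fun n => expR (x * e n ^+ 2)) (fun=> 1) (fun=> 0) (fun=> x).
Proof.
have P := expands_poly e01 (Oseq_cst e 0) (Oseq_cst e 0) (Oseq_cst e x).
have := expands_exp e01 e0 P.
by apply: expands_ext => n; rewrite ?expR0 ?mul1r; [congr expR|..]; ring.
Qed.

(** [(2p - 1) / e] for the risk-neutral probability [p], with [x = r * tau] and
    [c = sigma * sqrt tau]. It is even in [e], hence without a first order term. *)
Definition drift (x : R) n : R :=
  (2 * expR (x * e n ^+ 2) - U n - D n) / e n ^+ 2 / ((U n - D n) / e n).

Definition drift0 (x : R) : R := (2 * x - c ^+ 2) / (2 * c).
Definition drift2 (x : R) : R :=
  (x ^+ 2 - c ^+ 4 / 12) / (2 * c) - (2 * x - c ^+ 2) * c / 12.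

Hypothesis c_gt0 : 0 < c.

Lemma expands_drift (x : R) :
  expands e (drift x) (fun=> drift0 x) (fun=> 0) (fun=> drift2 x).
Proof.
have c2 : 2 * c != 0 by rewrite gt_eqF// mulr_gt0.
have := expandsM e01 (expands_second_difference x) (expands_inv e01 e0 c2 expands_first_difference).
by apply: expands_ext => n //; rewrite /drift0 /drift2; field; rewrite gt_eqF.
Qed.

Lemma expands_log_odds (s : nat -> R) (s0 s2 : R) :
  expands e s (fun=> s0) (fun=> 0) (fun=> s2) ->
  expands e (fun n => (ln (1 + s n * e n) - ln (1 - s n * e n)) / e n)
    (fun=> 2 * s0) (fun=> 0) (fun=> 2 * s2 + 2 * s0 ^+ 3 / 3).
Proof.
move=> sE; have sO := expands_bounded e01 sE.
pose X n := s n * e n.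
have XO : Oseq e 1 X by apply: OseqM0 => //; exact: (OseqXw 1 e01).
have X1 : \forall n \near \oo, `|X n| <= 2^-1 by apply: Oseq_near XO _.
pose P (u : R) := u - u ^+ 2 / 2 + u ^+ 3 / 3 - u ^+ 4 / 4 + u ^+ 5 / 5.
have X6 : Oseq e 6 (fun n => 2 * X n ^+ 6).
  apply: OseqM0; first exact: Oseq_cst.
  by have := OseqM (OseqM (OseqM XO XO) (OseqM XO XO)) (OseqM XO XO);
     apply: Oseq_eq; near=> n; ring.
have r1O : Oseq e 4 (fun n => ln (1 + X n) - P (X n)).
  apply: (@OseqW _ _ 6) => //; apply: Oseq_le X6; near=> n.
  have Xn : `|X n| <= 2^-1 by near: n.
  by apply: le_trans (ln_taylor Xn) _; rewrite [leRHS]normrM [`|X n ^+ 6|]normrX (@ger0_norm _ 2).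
have r2O : Oseq e 4 (fun n => ln (1 - X n) - P (- X n)).
  apply: (@OseqW _ _ 6) => //; apply: Oseq_le X6; near=> n.
  have Xn : `|- X n| <= 2^-1 by rewrite normrN; near: n.
  by apply: le_trans (ln_taylor Xn) _; rewrite [leRHS]normrM [`|X n ^+ 6|]normrX (@ger0_norm _ 2)// normrN.
have HR : expands e (fun n => (ln (1 + X n) - P (X n) - (ln (1 - X n) - P (- X n))) / e n
    + 2 / 5 * s n ^+ 5 * e n ^+ 4) (fun=> 0) (fun=> 0) (fun=> 0).
  split; try exact: Oseq_cst.
  have Q5 : Oseq e 4 (fun n => e n ^+ 4 * (2 / 5 * s n ^+ 5)) by apply: Oseq_wM => //; Oseq0.
  apply: Oseq_eq (OseqD (@Oseq_divn R 3 1 _ (OseqB r1O r2O)) (OseqW e01 (isT : (3 <= 4)%N) Q5)).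
  by near=> n; rewrite expr1; ring.
have s3 := expands_sqrM e01 (leadX e01 3 (expands_lead e01 sE)).
have := expandsD (expandsD (expandsZ 2 sE) (expandsZ (2 / 3) s3)) HR.
apply: expands_eq => [|n|n|n]; [|by field..].
near=> n.
have en : 0 < e n by near: n; exact: near_rsqrt.
by rewrite -/(X n) /P /X; field; rewrite gt_eqF.
Unshelve. all: by end_near. Qed.

End ElementaryExpansions.

(** * Expansion of the lookback price *)

Section LatticeCoordinates.
Variables (R : realType) (c x l : R).
Local Notation e := (rsqrt R).

Definition depth n : nat := `|Num.floor (l / e n)|%N.
Definition offset n : R := Defs.frac (l / e n).
(* A tail P(X >= k) is smooth in k only along one parity class; [parity] shifts
   the thresholds to the midpoints of the lattice of step 2. *)
Definition parity n : R := (odd (n - depth n))%:R.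
Definition prob n : R := (1 + drift c x n * e n) / 2.
(** This is [q]. Its complement is [prob] with [x] replaced by [-x], so the tails of the mirrored
    walk need no expansions of their own. *)
Definition probS n : R := (1 - drift c (- x) n * e n) / 2.
Definition odds_pow n : R := ((prob n / (1 - prob n)) ^+ (depth n).+1)^-1.

End LatticeCoordinates.

Section Pricing.
Variables (R : realType) (c x l : R).
Hypotheses (c_gt0 : 0 < c) (l_ge0 : 0 <= l).
Local Notation e := (rsqrt R).
Let e01 : small e := small_rsqrt R.
Let e0 : vanishing e := @vanishing_rsqrt R.
Let eO : Oseq e 0 e := Oseq_base e01.

Local Notation m := (depth l).
Local Notation f := (offset l).
Local Notation eps := (parity l).
Local Notation prob := (prob c x).
Local Notation probS := (probS c x).

Lemma depth_offset n : l / e n = (m n)%:R + f n.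
Proof.
rewrite /offset /Defs.frac /depth natr_absz ger0_norm ?floor_ge0; last first.
  by rewrite divr_ge0// invr_ge0 sqrtr_ge0.
by rewrite addrC subrK.
Qed.

Lemma offset_itv n : 0 <= f n < 1.
Proof.
have := floor_le_tmp (l / e n); have := lt_succ_floor (l / e n).
by rewrite /offset /Defs.frac intrD; lra.
Qed.

Lemma offset_bounded : Oseq e 0 f.
Proof.
exists 1; near=> n; have /andP[f0 f1] := offset_itv n.
by rewrite expr0 mulr1 ger0_norm// ltW.
Unshelve. all: by end_near. Qed.

Lemma parity_bounded : Oseq e 0 eps.
Proof.
exists 1; near=> n; rewrite expr0 mulr1 ger0_norm /parity ?ler0n//.
by rewrite lern1 leq_b1.
Unshelve. all: by end_near. Qed.

Lemma near_depth : \forall n \near \oo, (m n <= n)%N.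
Proof.
have lO : Oseq e 1 (fun n => l * e n).
  by apply: OseqM0; [exact: Oseq_cst|exact: (OseqXw 1 e01)].
have l1 := @Oseq_near _ _ _ 1 e01 e0 lO ltr01.
near=> n.
have en : 0 < e n by near: n; exact: near_rsqrt.
have el : l * e n <= 1 by apply: le_trans (ler_norm _) _; near: n.
have /andP[f0 _] := offset_itv n.
rewrite -(ler_nat R); apply: (@le_trans _ _ (l / e n)).
  by rewrite depth_offset lerDl.
have -> : n%:R = (e n ^+ 2)^-1 :> R by rewrite rsqrt_sqr invrK.
have -> : l / e n = (l * e n) * (e n ^+ 2)^-1 by field; rewrite gt_eqF.
by rewrite ler_piMl// invr_ge0 exprn_ge0// ltW.
Unshelve. all: by end_near. Qed.

(** [2 * uphalf k = k + odd k], and the depth is [l / e - f]. *)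
Lemma threshold_survival : \forall n \near \oo,
  2 * (uphalf (n - m n))%:R - n%:R - 1 = (- l + (f n + eps n - 1) * e n) / e n.
Proof.
have alg (N L F P E : R) : E != 0 ->
  N - (L / E - F) + P - N - 1 = (- L + (F + P - 1) * E) / E.
  by move=> ?; field.
near=> n.
have en : 0 < e n by near: n; exact: near_rsqrt.
have mn : (m n <= n)%N by near: n; exact: near_depth.
have E := depth_offset n.
have H : (2 * uphalf (n - m n) = n - m n + odd (n - m n))%N.
  by rewrite uphalf_half; have := odd_double_half (n - m n); lia.
have H2 : 2 * (uphalf (n - m n))%:R = n%:R - (m n)%:R + eps n :> R.
  by rewrite -natrM H natrD natrB.
rewrite H2; have -> : (m n)%:R = l / e n - f n by rewrite E addrK.
by apply: alg; rewrite gt_eqF.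
Unshelve. all: by end_near. Qed.

Lemma threshold_hit : \forall n \near \oo,
  2 * (uphalf (n + m n).+2)%:R - n%:R - 1 = (l + (1 - f n + eps n) * e n) / e n.
Proof.
have alg (N L F P E : R) : E != 0 ->
  N + (L / E - F) + 2 + P - N - 1 = (L + (1 - F + P) * E) / E.
  by move=> ?; field.
near=> n.
have en : 0 < e n by near: n; exact: near_rsqrt.
have mn : (m n <= n)%N by near: n; exact: near_depth.
have E := depth_offset n.
have H : (2 * uphalf (n + m n).+2 = n + m n + 2 + odd (n - m n))%N.
  by rewrite uphalf_half (oddB mn) -oddD; have := odd_double_half (n + m n).+2 => /=; lia.
have H2 : 2 * (uphalf (n + m n).+2)%:R = n%:R + (m n)%:R + 2 + eps n :> R.
  by rewrite -natrM H !natrD.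
rewrite H2; have -> : (m n)%:R = l / e n - f n by rewrite E addrK.
by apply: alg; rewrite gt_eqF.
Unshelve. all: by end_near. Qed.

(** [n + m + 1] and [n - m] have opposite parities, hence the opposite sign of [eps] compared with
    [threshold_hit]. *)
Lemma threshold_pre_hit : \forall n \near \oo,
  2 * (uphalf (n + m n).+1)%:R - n%:R - 1 = (l + (1 - f n - eps n) * e n) / e n.
Proof.
have alg (N L F P E : R) : E != 0 ->
  N + (L / E - F) + 2 - P - N - 1 = (L + (1 - F - P) * E) / E.
  by move=> ?; field.
near=> n.
have en : 0 < e n by near: n; exact: near_rsqrt.
have mn : (m n <= n)%N by near: n; exact: near_depth.
have E := depth_offset n.
have H : (2 * uphalf (n + m n).+1 + odd (n - m n) = n + m n + 2)%N.
  by rewrite uphalf_half (oddB mn) -oddD; have := odd_double_half (n + m n).+1 => /=; lia.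
have H2 : 2 * (uphalf (n + m n).+1)%:R = n%:R + (m n)%:R + 2 - eps n :> R.
  have : (2 * uphalf (n + m n).+1 + odd (n - m n))%:R = (n + m n + 2)%:R :> R by rewrite H.
  by rewrite !natrD natrM => <-; rewrite /parity; ring.
rewrite H2; have -> : (m n)%:R = l / e n - f n by rewrite E addrK.
by apply: alg; rewrite gt_eqF.
Unshelve. all: by end_near. Qed.

Let affine (z0 : R) (z1 : nat -> R) : Oseq e 0 z1 ->
  expands e (fun n => z0 + z1 n * e n) (fun=> z0) z1 (fun=> 0).
Proof.
move=> z1O; have := expands_poly e01 (Oseq_cst e z0) z1O (Oseq_cst e 0).
by apply: expands_ext => n //; ring.
Qed.

Let sp := drift0 c x.
Let sq := drift0 c (- x).

Lemma expands_tail_survival :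
  expands e (fun n => btail n (uphalf (n - m n)) (prob n))
    (fun=> Phi (sp + l)) (fun n => - (phi (sp + l) * (f n + eps n - 1)))
    (fun n => phi (sp + l) * (drift2 c x - (sp + l) * (f n + eps n - 1) ^+ 2 / 2
                              + edge_poly sp (- l))).
Proof.
have fO := offset_bounded; have pO := parity_bounded.
have zE : expands e (fun n => - l + (f n + eps n - 1) * e n) (fun=> - l)
    (fun n => f n + eps n - 1) (fun=> 0) by apply: affine; Oseq0.
have := expands_btail threshold_survival (expands_drift c_gt0 x) zE.
by rewrite opprK.
Qed.

Lemma expands_tail_hit :
  expands e (fun n => btail n (uphalf (n + m n).+2) (prob n))
    (fun=> Phi (sp - l)) (fun n => - (phi (sp - l) * (1 - f n + eps n)))
    (fun n => phi (sp - l) * (drift2 c x - (sp - l) * (1 - f n + eps n) ^+ 2 / 2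
                              + edge_poly sp l)).
Proof.
have fO := offset_bounded; have pO := parity_bounded.
have zE : expands e (fun n => l + (1 - f n + eps n) * e n) (fun=> l)
    (fun n => 1 - f n + eps n) (fun=> 0) by apply: affine; Oseq0.
exact: (expands_btail threshold_hit (expands_drift c_gt0 x) zE).
Qed.

Let sqE : expands e (drift c (- x)) (fun=> sq) (fun=> 0) (fun=> drift2 c (- x)) :=
  expands_drift c_gt0 (- x).

Let oneBprobS n : 1 - probS n = (1 + drift c (- x) n * e n) / 2.
Proof. by rewrite /probS; field. Qed.

Lemma expands_tailS_hit :
  expands e (fun n => btail n (uphalf (n + m n).+2) (1 - probS n))
    (fun=> Phi (sq - l)) (fun n => - (phi (sq - l) * (1 - f n + eps n)))
    (fun n => phi (sq - l) * (drift2 c (- x) - (sq - l) * (1 - f n + eps n) ^+ 2 / 2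
                              + edge_poly sq l)).
Proof.
have fO := offset_bounded; have pO := parity_bounded.
have zE : expands e (fun n => l + (1 - f n + eps n) * e n) (fun=> l)
    (fun n => 1 - f n + eps n) (fun=> 0) by apply: affine; Oseq0.
apply: (expands_ext _ _ _ _ (expands_btail threshold_hit sqE zE)) => // n.
by rewrite oneBprobS.
Qed.

Lemma expands_tailS_pre_hit :
  expands e (fun n => btail n (uphalf (n + m n).+1) (1 - probS n))
    (fun=> Phi (sq - l)) (fun n => - (phi (sq - l) * (1 - f n - eps n)))
    (fun n => phi (sq - l) * (drift2 c (- x) - (sq - l) * (1 - f n - eps n) ^+ 2 / 2
                              + edge_poly sq l)).
Proof.
have fO := offset_bounded; have pO := parity_bounded.
have zE : expands e (fun n => l + (1 - f n - eps n) * e n) (fun=> l)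
    (fun n => 1 - f n - eps n) (fun=> 0) by apply: affine; Oseq0.
apply: (expands_ext _ _ _ _ (expands_btail threshold_pre_hit sqE zE)) => // n.
by rewrite oneBprobS.
Qed.

Lemma expands_densityS_hit :
  expands e (fun n => tail_density (fun n => uphalf (n + m n).+2) n (drift c (- x) n))
    (fun=> phi (sq - l)) (fun n => (sq - l) * phi (sq - l) * (1 - f n + eps n))
    (fun n => phi (sq - l) * (- (sq - l) * drift2 c (- x)
      + ((sq - l) ^+ 2 - 1) * (1 - f n + eps n) ^+ 2 / 2 + edge_c l + edge_h sq l)).
Proof.
have fO := offset_bounded; have pO := parity_bounded.
have zE : expands e (fun n => l + (1 - f n + eps n) * e n) (fun=> l)
    (fun n => 1 - f n + eps n) (fun=> 0) by apply: affine; Oseq0.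
exact: (expands_tail_density threshold_hit sqE zE).
Qed.

Lemma near_prob : \forall n \near \oo, 0 < prob n < 1.
Proof.
have dO : Oseq e 1 (fun n => drift c x n * e n).
  apply: OseqM0; first exact: (expands_bounded e01 (expands_drift c_gt0 x)).
  exact: (OseqXw 1 e01).
have h := @Oseq_near _ _ _ 2^-1 e01 e0 dO; near=> n.
have : `|drift c x n * e n| <= 2^-1 by near: n; apply: h.
by rewrite ler_norml /prob; lra.
Unshelve. all: by end_near. Qed.

(** The exponent is [-(m+1)] times the log-odds, where [(m+1) * e = l + (1 - f) * e] and the
    log-odds divided by [e] expand without a first order term. *)
Lemma expands_odds_pow :
  expands e (odds_pow c x l)
    (fun=> expR (- (2 * l * sp)))
    (fun n => expR (- (2 * l * sp)) * (- (2 * (1 - f n) * sp)))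
    (fun n => expR (- (2 * l * sp)) * (- (2 * l * (drift2 c x + sp ^+ 3 / 3)))
       + expR (- (2 * l * sp)) * (- (2 * (1 - f n) * sp)) ^+ 2 / 2).
Proof.
have fO := offset_bounded.
have lE : expands e (fun n => l + (1 - f n) * e n) (fun=> l) (fun n => 1 - f n) (fun=> 0).
  by apply: affine; Oseq0.
have H := expandsZ (-1) (expandsM e01 lE (expands_log_odds (expands_drift c_gt0 x))).
have {}H := expands_exp e01 e0 H.
apply: (expands_eq _ _ _ _ H) => [|n|n|n]; last 3 first.
- by congr expR; rewrite /sp; ring.
- by congr (expR _ * _); rewrite /sp; ring.
- by congr (expR _ * _ + expR _ * _ ^+ 2 / 2); rewrite /sp; field.
near=> n.
have en : 0 < e n by near: n; exact: near_rsqrt.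
have pn : 0 < prob n < 1 by near: n; exact: near_prob.
have a1 : 0 < 1 + drift c x n * e n by move: pn; rewrite /prob; lra.
have a2 : 0 < 1 - drift c x n * e n by move: pn; rewrite /prob; lra.
rewrite /odds_pow.
have -> : prob n / (1 - prob n) = (1 + drift c x n * e n) / (1 - drift c x n * e n).
  rewrite /prob; field; rewrite gt_eqF//=; apply/eqP => E; move: a2; lra.
rewrite -ln_div ?posrE//; set o := _ / _.
have o0 : 0 < o by rewrite divr_gt0.
rewrite -[in LHS](lnK o0) -expRM_natl -expRN; congr expR.
have -> : l + (1 - f n) * e n = (m n).+1%:R * e n.
  have := depth_offset n => E; rewrite -natr1.
  have El : l = ((m n)%:R + f n) * e n by rewrite -E divfK// gt_eqF.
  by rewrite {1}El; ring.
by field; rewrite gt_eqF.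
Unshelve. all: by end_near. Qed.

End Pricing.

(** * Algebra of the one-step weights *)

Section Weights.
Variable R : realType.
Implicit Types U E : R.

Definition up_prob U E : R := (1 + (2 / E - U - U^-1) / (U - U^-1)) / 2.
Definition up_probS U E : R := (1 - (2 * E - U - U^-1) / (U - U^-1)) / 2.

Lemma up_probSE U E : 1 < U -> 0 < E -> up_probS U E = E * up_prob U E * U.
Proof.
move=> U1 E0; have U0 : U != 0 by rewrite gt_eqF//; lra.
have U2 : U ^+ 2 - 1 != 0 by rewrite gt_eqF//; nra.
rewrite /up_probS /up_prob; field.
by rewrite U0 U2 gt_eqF.
Qed.

Lemma up_probScE U E : 1 < U -> 0 < E -> 1 - up_probS U E = E * (1 - up_prob U E) / U.
Proof.
move=> U1 E0; have U0 : U != 0 by rewrite gt_eqF//; lra.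
have U2 : U ^+ 2 - 1 != 0 by rewrite gt_eqF//; nra.
rewrite /up_probS /up_prob; field.
by rewrite U0 U2 gt_eqF.
Qed.

Lemma up_prob_odds U E : 1 < U -> 0 < E -> up_prob U E < 1 ->
  0 < U * E - 1 /\ up_prob U E / (1 - up_prob U E) = (1 - E / U) / (U * E - 1).
Proof.
move=> U1 E0 p1; have U0 : U != 0 by rewrite gt_eqF//; lra.
have U2 : 0 < U ^+ 2 - 1 by nra.
have H : 1 - up_prob U E = (U * E - 1) * (U / (E * (U ^+ 2 - 1))).
  by rewrite /up_prob; field; rewrite U0 !gt_eqF.
have K0 : 0 < U / (E * (U ^+ 2 - 1)) by rewrite divr_gt0 ?mulr_gt0//; lra.
have UE : 0 < U * E - 1.
  by move: p1; rewrite -subr_gt0 H (pmulr_lgt0 _ K0).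
split => //; rewrite H /up_prob; field.
have U0p : 0 < U by lra.
by rewrite !gt_eqF.
Qed.

(** [o * U] is [lam] and [o * U * U] is [rho]. The common denominator [U * E - 1] drops out of the
    ratios. The factor [1 - E] shows that [lam = 1] exactly when [E = 1], that is, at zero interest
    rate. *)
Lemma value_weights U E (p := up_prob U E) (o := p / (1 - p)) :
  1 < U -> 0 < E -> p < 1 ->
  [/\ o * U - 1 = (1 - E) * (1 + U) / (U * E - 1),
      o - 1 = E * (2 / E - U - U^-1) / (U * E - 1) &
      o * U * U - 1 = - (U * (2 * E - U - U^-1)) / (U * E - 1)].
Proof.
move=> U1 E0 p1; have [UE oE] := up_prob_odds U1 E0 p1.
have U0 : 0 < U by lra.
by rewrite /o /p oE; split; field; rewrite !gt_eqF.
Qed.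

Lemma up_prob_martingale U (U1 : 1 < U) :
  up_prob U 1 = (1 + U)^-1 /\ up_probS U 1 = U / (1 + U).
Proof.
have U0 : 0 < U by lra.
have U2 : U ^+ 2 - 1 = (U - 1) * (1 + U) by ring.
have H : U ^+ 2 - 1 != 0 by rewrite U2 mulf_neq0 ?gt_eqF//; lra.
have H' : 1 + U != 0 by rewrite gt_eqF//; lra.
by split; rewrite /up_prob /up_probS; field; rewrite H H' gt_eqF.
Qed.

End Weights.

Section Value.
Variables (R : realType) (c x l : R).
Hypotheses (c_gt0 : 0 < c) (l_ge0 : 0 <= l).
Local Notation e := (rsqrt R).
Local Notation m := (depth l).
Local Notation f := (offset l).
Local Notation eps := (parity l).
Let e01 : small e := small_rsqrt R.
Let e0 : vanishing e := @vanishing_rsqrt R.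

Definition lookback_value n : R :=
  value (probS c x n) (fun j => expR (- j * (c * e n))) n (l / e n).

Lemma prob_up_prob n : 0 < e n ->
  prob c x n = up_prob (expR (c * e n)) (expR (- (x * e n ^+ 2))) /\
  probS c x n = up_probS (expR (c * e n)) (expR (- (x * e n ^+ 2))).
Proof.
move=> en; have U1 : 1 < expR (c * e n) by rewrite expR_gt1 mulr_gt0.
have alg (U r N : R) : 1 < U -> r != 0 -> N / r ^+ 2 / ((U - U^-1) / r) * r = N / (U - U^-1).
  move=> U1' r0; have U0 : U != 0 by rewrite gt_eqF//; lra.
  have U2 : U ^+ 2 - 1 != 0 by rewrite gt_eqF//; nra.
  by field; rewrite U0 U2 r0.
have e0' : e n != 0 by rewrite gt_eqF.
rewrite /prob /probS /up_prob /up_probS /drift !expRN !alg// !invrK mulNr expRN.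
by split.
Qed.

Let prob_facts n : 0 < e n -> 0 < prob c x n < 1 ->
  let p := prob c x n in let q := probS c x n in
  let U := expR (c * e n) in let E := expR (- (x * e n ^+ 2)) in
  [/\ 1 < U, 0 < E, p = up_prob U E, q = E * p * U & 1 - q = E * (1 - p) / U].
Proof.
move=> en pn p q U E; have [pE qE] := prob_up_prob en.
have U1 : 1 < U by rewrite expR_gt1 mulr_gt0.
have E0 : 0 < E by exact: expR_gt0.
split => //; rewrite /q qE /p pE; [exact: up_probSE|exact: up_probScE].
Qed.

Lemma value_split n : 0 < e n -> (0 < n)%N -> 0 < prob c x n < 1 -> (m n <= n)%N ->
  lookback_value n = expR (- (l * c)) * expR (- x) *
    (btail n (uphalf (n - m n)) (prob c x n)
     - odds_pow c x l n * btail n (uphalf (n + m n).+2) (prob c x n))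
  + upper (c * e n) (prob c x n) (probS c x n) n (m n).
Proof.
move=> en n0 pn mn; have [U1 E0 pE qE qcE] := prob_facts en pn.
have /andP[p0 p1] := pn.
rewrite /lookback_value depth_offset// (value_closed p0 p1 qE qcE _ _ (offset_itv _ _))//.
rewrite (survival_tails _ _ _ mn)// -depth_offset//.
congr (_ * _ * _ + _).
  by congr expR; field; rewrite gt_eqF.
rewrite -expRM_natl; congr expR; rewrite rsqrt_sqr.
by field; rewrite pnatr_eq0 -lt0n.
Qed.

Let U n := expR (c * e n).
Let D n := expR (- (c * e n)).

(** [(odds - 1) / (lam - 1)] after cancelling [U * E - 1]. What is left above and below is of order
    [e ^+ 2]; dividing both by it produces factors that expand, with a denominator tending to
    [2 * x]. *)
Definition hit_ratio n : R :=
  expR (- x * e n ^+ 2) * ((2 * expR (x * e n ^+ 2) - U n - D n) / e n ^+ 2)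
  * ((1 - expR (- x * e n ^+ 2)) / e n ^+ 2 * (1 + U n))^-1.

Definition hitS_ratio n : R :=
  - U n * ((2 * expR (- x * e n ^+ 2) - U n - D n) / e n ^+ 2)
  * ((1 - expR (- x * e n ^+ 2)) / e n ^+ 2 * (1 + U n))^-1.

Lemma hit_ratios n : 0 < x -> 0 < e n -> 0 < prob c x n < 1 ->
  let o := prob c x n / (1 - prob c x n) in
  [/\ o * U n - 1 != 0, (o - 1) / (o * U n - 1) = hit_ratio n
    & (o * U n * U n - 1) / (o * U n - 1) = hitS_ratio n].
Proof.
move=> x0 en pn; have [U1 E0 pE _ _] := prob_facts en pn.
rewrite pE; have p1 : up_prob (U n) (expR (- (x * e n ^+ 2))) < 1 by rewrite -pE; lra.
have [UE _] := up_prob_odds U1 E0 p1.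
have := value_weights U1 E0 p1; cbv zeta; rewrite -/(U n) => -[-> -> ->].
have E1 : expR (- (x * e n ^+ 2)) < 1.
  by rewrite expR_lt1 oppr_lt0 mulr_gt0 ?exprn_gt0.
have U0 : 0 < U n by exact: expR_gt0.
have alg (E V r : R) : 0 < E -> E < 1 -> 0 < V -> 0 < V * E - 1 -> 0 < r ->
  [/\ (1 - E) * (1 + V) / (V * E - 1) != 0,
    E * (2 / E - V - V^-1) / (V * E - 1) / ((1 - E) * (1 + V) / (V * E - 1))
    = E * ((2 * E^-1 - V - V^-1) / r) / ((1 - E) / r * (1 + V)) &
    - (V * (2 * E - V - V^-1)) / (V * E - 1) / ((1 - E) * (1 + V) / (V * E - 1))
    = - V * ((2 * E - V - V^-1) / r) / ((1 - E) / r * (1 + V))].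
  move=> hE hE1 hV hVE hr; have hE2 : 1 - E != 0 by rewrite gt_eqF//; lra.
  have hV2 : 1 + V != 0 by rewrite gt_eqF//; lra.
  have hVE' := lt0r_neq0 hVE; have hV' := lt0r_neq0 hV; have hE' := lt0r_neq0 hE.
  split; first by rewrite !mulf_neq0// invr_neq0.
  - by field; rewrite hE2 hV2 hVE' hV' hE' lt0r_neq0.
  - by field; rewrite hE2 hV2 hVE' hV' lt0r_neq0.
have e2 : 0 < e n ^+ 2 by rewrite exprn_gt0.
have [H1 H2 H3] := alg _ _ _ E0 E1 U0 UE e2.
have Ex : - x * e n ^+ 2 = - (x * e n ^+ 2) by ring.
split; first exact: H1.
  by rewrite H2 /hit_ratio /D Ex !expRN ?invrK.
by rewrite H3 /hitS_ratio /D Ex !expRN.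
Qed.

(** Writing [u^-m] as [u^-j0 * u^f] gives the reflected contributions of [survival] and of [upper]
    the same weight [odds_pow]. The two mirrored tails with adjacent thresholds are kept as a
    difference, which is of first order. *)
Lemma value_pos : 0 < x -> \forall n \near \oo, lookback_value n =
  expR (- (l * c)) * expR (- x) * btail n (uphalf (n - m n)) (prob c x n)
  + expR (- (l * c)) * expR (- x) * odds_pow c x l n * btail n (uphalf (n + m n).+2) (prob c x n)
    * (expR (f n * c * e n) * hit_ratio n - 1)
  + hitS_ratio n * btail n (uphalf (n + m n).+2) (1 - probS c x n)
  + (btail n (uphalf (n + m n).+1) (1 - probS c x n)
     - btail n (uphalf (n + m n).+2) (1 - probS c x n)).
Proof.
move=> x0.
have exponent (E F M : R) : E != 0 -> l / E = M + F -> - (l * c) + F * c * E = - (M * (c * E)).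
  move=> E0 H; have -> : l = (M + F) * E by rewrite -H divfK.
  by ring.
have weight (o om k V B : R) : o != 0 -> om != 0 -> k != 0 -> V != 0 ->
    (1 - o^-1) / k * ((om * V)^-1 * B) = V^-1 * B * (o * om)^-1 * ((o - 1) / k).
  by move=> o0 om0 k0 V0; field; rewrite o0 om0 k0 V0.
have finish (A B F P T1 T2 T3 T4 h hS : R) : A * B * (T1 - P * T2)
    + (A * F * B * P * h * T2 + (hS - 1) * T3 + T4)
    = A * B * T1 + A * B * P * T2 * (F * h - 1) + hS * T3 + (T4 - T3).
  by ring.
near=> n.
have en : 0 < e n by near: n; exact: near_rsqrt.
have n0 : (0 < n)%N by near: n; exists 1%N.
have pn : 0 < prob c x n < 1 by near: n; exact: near_prob.
have mn : (m n <= n)%N by near: n; exact: near_depth.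
have [U1 E0 pE qE qcE] := prob_facts en pn.
have /andP[p0 p1] := pn.
have [lam1 w1 w2] := hit_ratios x0 en pn.
have lam1' : prob c x n / (1 - prob c x n) * expR (c * e n) != 1 by rewrite -subr_eq0.
have H := upper_tails p0 p1 qE qcE n (m n) lam1'.
have o0 : prob c x n / (1 - prob c x n) != 0 by rewrite gt_eqF// divr_gt0// subr_gt0.
have En : expR (- (x * e n ^+ 2)) ^+ n = expR (- x).
  rewrite -expRM_natl rsqrt_sqr; congr expR.
  by rewrite mulrN mulrCA divff ?mulr1// pnatr_eq0 -lt0n.
have Um : expR (- (l * c)) * expR (f n * c * e n) = (expR (c * e n) ^+ m n)^-1.
  rewrite -expRD -expRM_natl -expRN; congr expR.
  by apply: exponent; rewrite ?gt_eqF//; exact: depth_offset.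
have key := weight _ _ _ (expR (c * e n) ^+ m n) (expR (- x)) o0 (expf_neq0 (m n) o0) lam1
  (lt0r_neq0 (exprn_gt0 (m n) (expR_gt0 (c * e n)))).
rewrite value_split// H En exprMn -/(U n) key -exprS -/(odds_pow c x l n) w1 w2 -Um.
exact: finish.
Unshelve. all: by end_near. Qed.

(** Here [E = 1] forces [odds = 1/u], so [lam = 1]. The derivative of the tail is of order [1/e],
    but its coefficient [1 - u] is of order [e], hence the grouping by [(1 - u) / e]. *)
Lemma value_zero : x = 0 -> \forall n \near \oo, lookback_value n =
  expR (- (l * c)) * expR (- x) * btail n (uphalf (n - m n)) (prob c x n)
  - expR (- (l * c)) * expR (- x) * odds_pow c x l n * btail n (uphalf (n + m n).+2) (prob c x n)
  + (1 - expR (c * e n)) / e n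
    * ((drift c (- x) n - l + f n * e n) * btail n (uphalf (n + m n).+2) (1 - probS c x n)
       + (1 - e n ^+ 2 * drift c (- x) n ^+ 2)
         * tail_density (fun n => uphalf (n + m n).+2) n (drift c (- x) n))
  + (2 * expR (c * e n) - 1) * btail n (uphalf (n + m n).+2) (1 - probS c x n)
  + btail n (uphalf (n + m n).+1) (1 - probS c x n).
Proof.
move=> x0.
have finish (A B P T1 T2 T3 T4 V s F BD E M : R) : E != 0 -> l / E = M + F ->
    A * B * (T1 - P * T2) + ((1 - V) * (((E ^+ 2)^-1 * (1 - 2 * ((1 - s * E) / 2)) - M) * T3
      + 2 * (1 - (1 - s * E) / 2) * ((1 - s * E) / 2) * BD) + (2 * V - 1) * T3 + T4)
    = A * B * T1 - A * B * P * T2 + (1 - V) / E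
      * ((s - l + F * E) * T3 + (1 - E ^+ 2 * s ^+ 2) * (BD * (E / 2)))
      + (2 * V - 1) * T3 + T4.
  move=> E0 H; have -> : M = l / E - F by rewrite H addrK.
  by field.
near=> n.
have en : 0 < e n by near: n; exact: near_rsqrt.
have n0 : (0 < n)%N by near: n; exists 1%N.
have pn : 0 < prob c x n < 1 by near: n; exact: near_prob.
have mn : (m n <= n)%N by near: n; exact: near_depth.
have [U1 E0 pE qE qcE] := prob_facts en pn.
have /andP[p0 p1] := pn.
have lam1 : prob c x n / (1 - prob c x n) * expR (c * e n) = 1.
  have [H _] := up_prob_martingale U1.
  rewrite pE x0 mul0r oppr0 expR0 H.
  have U0 : 0 < expR (c * e n) by exact: expR_gt0.
  move: (expR (c * e n)) U0 => V V0.
  have -> : 1 - (1 + V)^-1 = V / (1 + V) by field; rewrite gt_eqF//; lra.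
  by field; rewrite !gt_eqF//; lra.
have H := upper_tails1 (probS c x n) p0 p1 n (m n) lam1.
have en' : e n != 0 by rewrite gt_eqF.
rewrite value_split// H tail_densityE.
have -> : root18 R n ^+ 9 = e n by rewrite root18_sqrt.
have -> : (1 + drift c (- x) n * e n) / 2 = 1 - probS c x n.
  by rewrite /probS; field.
have -> : n%:R = (e n ^+ 2)^-1 :> R by rewrite rsqrt_sqr invrK.
by rewrite -(finish _ _ _ _ _ _ _ _ _ _ _ _ _ en' (depth_offset l_ge0 n)).
Unshelve. all: by end_near. Qed.

End Value.

(** * Collecting the coefficients of the price *)

Section Coefficients.
Variables (R : realType) (c x l : R).
Hypotheses (c_gt0 : 0 < c) (l_ge0 : 0 <= l).
Local Notation e := (rsqrt R).
Local Notation m := (depth l).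
Local Notation f := (offset l).
Local Notation eps := (parity l).
Let e01 : small e := small_rsqrt R.
Let e0 : vanishing e := @vanishing_rsqrt R.
Local Notation A := (expR (- (l * c)) * expR (- x)).
Local Notation sp := (drift0 c x).
Local Notation sq := (drift0 c (- x)).
Local Notation O0 := (expR (- (2 * l * sp))).
Local Notation X := (phi (sq - l)).

(** The Black-Scholes identity [M * exp(-r tau) * phi(d2) = S * phi(d1)]. With [phi_reflected], it
    lets every density be written as [X], which is what makes the density terms combine. *)
Lemma phi_discounted : A * phi (sp + l) = X.
Proof.
rewrite /phi mulrA -!expRD; congr (expR _ / _); rewrite /drift0.
by field; rewrite gt_eqF.
Qed.

Lemma phi_reflected : A * O0 * phi (sp - l) = X.
Proof.
rewrite /phi mulrA -!expRD; congr (expR _ / _); rewrite /drift0.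
by field; rewrite gt_eqF.
Qed.

Lemma expands_survival_term :
  expands e (fun n => A * btail n (uphalf (n - m n)) (prob c x n))
    (fun=> A * Phi (sp + l)) (fun n => X * (1 - f n - eps n))
    (fun n => X * (drift2 c x - (sp + l) * (f n + eps n - 1) ^+ 2 / 2 + edge_poly sp (- l))).
Proof.
have := expandsZ A (expands_tail_survival x c_gt0 l_ge0).
apply: expands_ext => n //; rewrite -phi_discounted; ring.
Qed.

Lemma expands_reflected_term :
  expands e (fun n => A * odds_pow c x l n * btail n (uphalf (n + m n).+2) (prob c x n))
    (fun=> A * O0 * Phi (sp - l))
    (fun n => - (2 * (1 - f n) * sp) * (A * O0 * Phi (sp - l)) - X * (1 - f n + eps n))
    (fun n => (2 * (1 - f n) ^+ 2 * sp ^+ 2 - 2 * l * (drift2 c x + sp ^+ 3 / 3))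
                * (A * O0 * Phi (sp - l))
      + X * (drift2 c x - (sp - l) * (1 - f n + eps n) ^+ 2 / 2 + edge_poly sp l
             + 2 * (1 - f n) * sp * (1 - f n + eps n))).
Proof.
have := expandsM e01 (expandsZ A (expands_odds_pow x c_gt0 l_ge0)) (expands_tail_hit x c_gt0 l_ge0).
by apply: expands_ext => n //; rewrite -phi_reflected; field.
Qed.

Let U n := expR (c * e n).

Let U1E : expands e (fun n => 1 + U n) (fun=> 2) (fun=> c) (fun=> c ^+ 2 / 2).
Proof.
have := expandsD (expands_cst e01 1) (expands_exp_e (Oseq_cst e c)).
by apply: expands_ext => n //; ring.
Qed.

Lemma expands_hit_ratio : 0 < x -> expands e (hit_ratio c x)
  (fun=> (2 * x - c ^+ 2) / (2 * x)) (fun=> - c * (2 * x - c ^+ 2) / (4 * x))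
  (fun=> (x * c ^+ 2 / 2 - c ^+ 4 / 12) / (2 * x)).
Proof.
move=> x0; have x2 : x * 2 != 0 by rewrite gt_eqF// mulr_gt0.
have H := expandsM e01 (expands_discount x) U1E.
have K := expandsM e01 (expands_exp_e2 (- x)) (expands_second_difference c x).
have := expandsM e01 K (expands_inv e01 e0 x2 H).
by apply: expands_ext => n //; field; rewrite gt_eqF.
Qed.

Lemma expands_hitS_ratio : 0 < x -> expands e (hitS_ratio c x)
  (fun=> (2 * x + c ^+ 2) / (2 * x)) (fun=> c * (2 * x + c ^+ 2) / (4 * x))
  (fun=> (x * c ^+ 2 / 2 + c ^+ 4 / 12) / (2 * x)).
Proof.
move=> x0; have x2 : x * 2 != 0 by rewrite gt_eqF// mulr_gt0.
have H := expandsM e01 (expands_discount x) U1E.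
have K := expandsM e01 (expandsZ (-1) (expands_exp_e (Oseq_cst e c))) (expands_second_difference c (- x)).
have := expandsM e01 K (expands_inv e01 e0 x2 H).
apply: expands_ext => n //; try by field; rewrite gt_eqF.
by rewrite /hitS_ratio mulN1r.
Qed.

Let eps01 n : eps n = 0 \/ eps n = 1.
Proof. by rewrite /parity; case: (odd _); [right|left]. Qed.

Lemma expands_value_pos : 0 < x ->
  let theta1 := 1 + c ^+ 2 / (2 * x) in let theta2 := 1 - c ^+ 2 / (2 * x) in
  let B1 := Phi (sq - l) in let B3 := A * O0 * Phi (sp - l) in
  expands e (fun n => 1 - lookback_value c x l n)
    (fun=> 1 - theta1 * B1 - A * Phi (sp + l) + (1 - theta2) * B3)
    (fun=> - (c / 2 * (theta1 * B1 + theta2 * B3)))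
    (fun n => - (c ^+ 2 / 12 * ((theta1 + 2) * B1 + (theta2 + 2
         - (12 * x / c ^+ 2 * theta2 * (f n * (1 - f n)) - (1 + 4 * x ^+ 2 / c ^+ 4) * (l * c))) * B3)
       - c * X * (1 / 2 + f n * (1 - f n) + (sp - l + c) / 6 * l))).
Proof.
move=> x0 theta1 theta2 B1 B3.
have fO := offset_bounded l.
have fcO : Oseq e 0 (fun n => f n * c) by apply: OseqM0 => //; exact: Oseq_cst.
have W := expandsD (expandsM e01 (expands_exp_e fcO) (expands_hit_ratio x0)) (expands_cst e01 (-1)).
have V := expandsD (expandsD (expandsD expands_survival_term
    (expandsM e01 expands_reflected_term W))
    (expandsM e01 (expands_hitS_ratio x0) (expands_tailS_hit x c_gt0 l_ge0)))
  (expandsD (expands_tailS_pre_hit x c_gt0 l_ge0)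
            (expandsZ (-1) (expands_tailS_hit x c_gt0 l_ge0))).
have VE := value_pos c_gt0 l_ge0 x0.
have H := expandsD (expands_cst e01 1) (expandsZ (-1) V).
apply: (expands_eq _ _ _ _ H) => [|n|n|n].
- by apply: filterS VE => n ->; rewrite mulN1r [-1 * _]mulN1r.
- rewrite /theta1 /theta2 /B1 /B3; set Q1 := Phi _; set Q2 := _ * Phi (sp - l); set Q3 := _ * Phi _.
  by field; rewrite gt_eqF.
- rewrite /theta1 /theta2 /B1 /B3.
  set Q1 := Phi (sq - l); set Q2 := _ * Phi (sp - l); set Q3 := X.
  by case: (eps01 n) => ->; rewrite /drift0; field; rewrite !gt_eqF.
rewrite /theta1 /theta2 /B1 /B3.
set Q1 := Phi (sq - l); set Q2 := _ * Phi (sp - l); set Q3 := X; set F := f n.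
(* The second order coefficient retains a multiple of [eps ^+ 2 - eps], so the parity disappears
   only because it is 0 or 1; hence the case split. *)
case: (eps01 n) => ->; rewrite /drift2 /edge_poly /drift0; field; rewrite !gt_eqF//.
Qed.

Lemma expands_value_zero : x = 0 ->
  let B1 := Phi (sq - l) in let B3 := (l * c + c ^+ 2 / 2) * B1 in
  expands e (fun n => 1 - lookback_value c x l n)
    (fun=> 1 - B1 - A * Phi (sp + l) - (B3 - c * X))
    (fun=> - (c / 2 * (2 * B1 + B3 - c * X)))
    (fun n => - (c ^+ 2 / 6 * ((3 + 3 * (f n * (1 - f n)) - c ^+ 2 / 4) * B1 + B3)
       - (1 / 2 + f n * (1 - f n) + c ^+ 2 / 12 - (sp + l) / 6 * l) * (c * X))).
Proof.
move=> x0 B1 B3.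
have fO := offset_bounded l.
have sE := expands_drift c_gt0 (- x).
have fE : expands e (fun n => - l + f n * e n) (fun=> - l) f (fun=> 0).
  have := expands_poly e01 (Oseq_cst e (- l)) fO (Oseq_cst e 0).
  by apply: expands_ext => n //; ring.
have vE := expandsD (expands_cst e01 1) (expandsZ (-1) (expands_sqrM e01 (leadX e01 2 (expands_lead e01 sE)))).
have inner := expandsD (expandsM e01 (expandsD sE fE) (expands_tailS_hit x c_gt0 l_ge0))
  (expandsM e01 vE (expands_densityS_hit x c_gt0 l_ge0)).
have U2 := expandsD (expandsZ 2 (expands_exp_e (Oseq_cst e c))) (expands_cst e01 (-1)).
have V := expandsD (expandsD (expandsD (expandsD expands_survival_term
    (expandsZ (-1) expands_reflected_term))
    (expandsM e01 (expands_oneBexp c) inner))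
    (expandsM e01 U2 (expands_tailS_hit x c_gt0 l_ge0)))
  (expands_tailS_pre_hit x c_gt0 l_ge0).
have VE := value_zero c_gt0 l_ge0 x0.
have H := expandsD (expands_cst e01 1) (expandsZ (-1) V).
(* For [x = 0] the drift is [-c/2], so the reflection weight cancels [exp(-l c)]. As also [sp = sq],
   the reflected tail merges with the mirrored ones. *)
have AO : A * O0 = 1.
  rewrite -!expRD -[RHS]expR0; congr expR; rewrite x0 /drift0; field.
  by rewrite gt_eqF.
have spE : sp = sq by rewrite x0 oppr0.
apply: (expands_eq _ _ _ _ H) => [|n|n|n].
- by apply: filterS VE => n ->; rewrite !mulN1r -[drift _ _ _ - l + _]addrA.
- rewrite /B3 /B1 AO spE; set Q1 := Phi (sq - l); set Q2 := _ * Phi (sq + l); set Q3 := X.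
  by rewrite x0 /drift0; field; rewrite gt_eqF.
- rewrite /B3 /B1 AO spE; set Q1 := Phi (sq - l); set Q2 := X.
  by case: (eps01 n) => ->; rewrite x0 /drift0; field; rewrite !gt_eqF.
rewrite /B3 /B1 AO spE.
set Q1 := Phi (sq - l); set Q3 := X; set F := f n.
by case: (eps01 n) => ->; rewrite x0 /drift2 /edge_poly /edge_h /edge_c /drift0; field; rewrite !gt_eqF.
Qed.

End Coefficients.

(** * Return to the parameters of the option *)

Section Translation.
Variables (R : realType) (r sigma tau S M : R).
Hypotheses (tau_gt0 : 0 < tau) (sigma_gt0 : 0 < sigma).
Hypotheses (M_gt0 : 0 < M) (M_le_S : M <= S).
Local Notation e := (rsqrt R).
Local Notation h := (Num.sqrt tau).
Local Notation c := (sigma * h).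
Local Notation x := (r * tau).
Local Notation L := (ln (S / M)).
Local Notation l := (L / c).

Lemma sqrt_tau_gt0 : 0 < h. Proof. by rewrite sqrtr_gt0. Qed.

Lemma sqrt_tau_sqr : tau = h ^+ 2. Proof. by rewrite sqr_sqrtr// ltW. Qed.

Lemma vol_gt0 : 0 < c. Proof. by rewrite mulr_gt0// sqrt_tau_gt0. Qed.

Lemma S_gt0 : 0 < S. Proof. exact: lt_le_trans M_le_S. Qed.

Lemma log_moneyness_ge0 : 0 <= l.
Proof.
by rewrite divr_ge0 ?(ltW vol_gt0)// ln_ge0// ler_pdivlMr// mul1r.
Qed.

Lemma stepE n : sigma * Num.sqrt (tau / n%:R) = c * e n.
Proof. by rewrite sqrtrM ?ltW// sqrtrV ?ler0n// mulrA. Qed.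

Lemma j0E n : j0_ sigma tau S M n = l / e n.
Proof. by rewrite /j0_ stepE invfM mulrA. Qed.

Lemma kappaE n : kappa_ sigma tau S M n = offset l n * (1 - offset l n).
Proof. by rewrite /kappa_ j0E. Qed.

Lemma Cfl_value n : (0 < n)%N ->
  Cfl_n r sigma tau S M n = S * (1 - lookback_value c x l n).
Proof.
move=> n0; have en : 0 < e n by exact: rsqrt_gt0.
have qE : q_ r sigma tau n = probS c x n.
  have [_ ->] := prob_up_prob x vol_gt0 en.
  rewrite /q_ /u_ stepE -rsqrt_sqr /up_probS.
  have U1 : 1 < expR (c * e n) by rewrite expR_gt1 mulr_gt0 ?vol_gt0.
  move: (expR (c * e n)) (expR (- _)) U1 => U E U1.
  have U2 : U ^+ 2 - 1 != 0 by rewrite gt_eqF//; nra.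
  by field; rewrite U2 gt_eqF//; lra.
rewrite /Cfl_n j0E qE sum_Jset; congr (_ * _).
rewrite (_ : (fun j : R => 1 - u_ sigma tau n `^ (- j)) =
  (fun j => 1 - expR (- j * (c * e n)))).
  by rewrite value_complement.
by apply/funext => j; rewrite /u_ stepE [- j * _]mulrC (expRM (c * e n)).
Qed.

Lemma discounted_ratio : expR (- (l * c)) = M / S.
Proof.
rewrite divfK ?gt_eqF ?vol_gt0// expRN lnK ?posrE ?divr_gt0 ?S_gt0//.
by rewrite invf_div.
Qed.

Lemma expands_Cfl (a b d : nat -> R) (target : nat -> R) :
  expands e (fun n => 1 - lookback_value c x l n) a b d ->
  (forall n, target n = S * (a n + b n * e n + d n * e n ^+ 2)) ->
  exists (C : R) (N : nat), forall n, (N <= n)%N ->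
    `|Cfl_n r sigma tau S M n - target n| <= C / Num.sqrt n%:R ^+ 3.
Proof.
move=> [_ _ _ H] T.
have [C [N _ HN]] := OseqM0 (Oseq_cst e S) H.
exists C, N.+1 => n Nn; rewrite T Cfl_value; last exact: leq_trans Nn.
by rewrite -mulrBr -exprVn; apply: HN => /=; exact: ltnW.
Qed.

Lemma d1E : d1_ r sigma tau S M = - (drift0 c (- x) - l).
Proof.
rewrite /d1_ /drift0; move: (Num.sqrt tau) sqrt_tau_gt0 sqrt_tau_sqr => h h0 ->.
by field; rewrite !gt_eqF.
Qed.

Lemma d2E : d2_ r sigma tau S M = drift0 c x + l.
Proof.
rewrite /d2_ d1E /drift0; move: (Num.sqrt tau) sqrt_tau_gt0 sqrt_tau_sqr => h h0 ->.
by field; rewrite !gt_eqF.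
Qed.

Lemma d3E : d3_ r sigma tau S M = drift0 c x - l.
Proof.
rewrite /d3_ d1E /drift0; move: (Num.sqrt tau) sqrt_tau_gt0 sqrt_tau_sqr => h h0 ->.
by field; rewrite !gt_eqF.
Qed.

(** The limiting reflection weight is [(S/M)^(1 - 2r/sigma^2)]; the factor [M/S] removes the 1 from
    the exponent. *)
Lemma B3E : expR (- x) * (S / M) `^ (- (2 * r / sigma ^+ 2)) =
  expR (- (l * c)) * expR (- x) * expR (- (2 * l * drift0 c x)).
Proof.
have SM : 0 < S / M by rewrite divr_gt0 ?S_gt0.
rewrite -{1}[S / M]lnK ?posrE// -expRM -!expRD; congr expR.
rewrite /drift0; move: (Num.sqrt tau) sqrt_tau_gt0 sqrt_tau_sqr => h h0 ->.
by field; rewrite !gt_eqF.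
Qed.

(** The averaged exponent in [d1] and [d4], combined with the power of [S/M], collapses to [S/M]
    times the Gaussian in [d1] alone. *)
Lemma B4E : M * (c * (S / M) `^ ((1 - 2 * r / sigma ^+ 2) / 2)
    * expR (- (d1_ r sigma tau S M ^+ 2 + d4_ r sigma tau S M ^+ 2) / 4) / Num.sqrt (2 * pi))
  = S * (c * phi (drift0 c (- x) - l)).
Proof.
have SM : 0 < S / M by rewrite divr_gt0 ?S_gt0.
have E : (S / M) `^ ((1 - 2 * r / sigma ^+ 2) / 2)
    * expR (- (d1_ r sigma tau S M ^+ 2 + d4_ r sigma tau S M ^+ 2) / 4)
    = S / M * expR (- (drift0 c (- x) - l) ^+ 2 / 2).
  rewrite -{1 2}[S / M]lnK ?posrE// -expRM -!expRD; congr expR.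
  rewrite /d4_ d3E d1E /drift0.
  move: (Num.sqrt tau) sqrt_tau_gt0 sqrt_tau_sqr => h h0 ->.
  by field; rewrite !gt_eqF.
rewrite -[c * _ * _]mulrA E /phi; field.
by rewrite !gt_eqF ?sqrt2pi_gt0.
Qed.

End Translation.

(** Pure algebra: [v] stands for [1/sqrt n], [w] for [1/n], [k] for the kappa term, and [c^2/(2x)]
    equals [sigma^2/(2r)]. *)
Lemma target_pos (R : realType) (S M r sg h tau L B1 B3 B4 X E P2 d4 k v w : R) :
  w = v ^+ 2 -> S != 0 -> r != 0 -> sg != 0 -> h != 0 -> tau = h ^+ 2 -> M * B4 = S * (sg * h * X) ->
  let c := sg * h in let x := r * tau in
  let th1 := 1 + sg ^+ 2 / (2 * r) in let th2 := 1 - sg ^+ 2 / (2 * r) in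
  S - S * th1 * B1 - M * (E * P2) + S * (1 - th2) * B3
  - S * (sg * h / 2) * (th1 * B1 + th2 * B3) * v
  - (S * (sg ^+ 2 * tau / 12) * ((th1 + 2) * B1 + (th2 + 2
       - (12 * r / sg ^+ 2 * th2 * k - (1 + 4 * r ^+ 2 / sg ^+ 4) * L)) * B3)
     - M * (1 / 2 + k + d4 / (6 * sg * h) * L) * B4) * w
  = S * (1 - (1 + c ^+ 2 / (2 * x)) * B1 - M / S * E * P2 + (1 - (1 - c ^+ 2 / (2 * x))) * B3
      + - (c / 2 * ((1 + c ^+ 2 / (2 * x)) * B1 + (1 - c ^+ 2 / (2 * x)) * B3)) * v
      + - (c ^+ 2 / 12 * ((1 + c ^+ 2 / (2 * x) + 2) * B1 + (1 - c ^+ 2 / (2 * x) + 2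
           - (12 * x / c ^+ 2 * (1 - c ^+ 2 / (2 * x)) * k
              - (1 + 4 * x ^+ 2 / c ^+ 4) * (L / c * c))) * B3)
         - c * X * (1 / 2 + k + d4 / 6 * (L / c))) * v ^+ 2).
Proof.
move=> -> S0 r0 sg0 h0 -> MB c x th1 th2; rewrite /c /x /th1 /th2.
rewrite (mulrAC M _ B4) MB; field.
by rewrite S0 r0 sg0 h0.
Qed.

Lemma target_zero (R : realType) (S M sg h tau L B1 B3 B4 X E P2 d2 k v w : R) :
  w = v ^+ 2 -> S != 0 -> sg != 0 -> h != 0 -> tau = h ^+ 2 -> B4 = sg * h * X ->
  B3 = (L + sg ^+ 2 * tau / 2) * B1 ->
  let c := sg * h in
  S - S * B1 - M * (E * P2) - S * (B3 - B4)
  - S * (sg * h / 2) * (2 * B1 + B3 - B4) * v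
  - (S * (sg ^+ 2 * tau / 6) * ((3 + 3 * k - sg ^+ 2 * tau / 4) * B1 + B3)
     - S * (1 / 2 + k + sg ^+ 2 * tau / 12 - d2 / (6 * sg * h) * L) * B4) * w
  = S * (1 - B1 - M / S * E * P2 - ((L / c * c + c ^+ 2 / 2) * B1 - c * X)
      + - (c / 2 * (2 * B1 + (L / c * c + c ^+ 2 / 2) * B1 - c * X)) * v
      + - (c ^+ 2 / 6 * ((3 + 3 * k - c ^+ 2 / 4) * B1 + (L / c * c + c ^+ 2 / 2) * B1)
         - (1 / 2 + k + c ^+ 2 / 12 - d2 / 6 * (L / c)) * (c * X)) * v ^+ 2).
Proof.
move=> -> S0 sg0 h0 -> -> -> c; rewrite /c; field.
by rewrite S0 sg0 h0.
Qed.

Theorem theorem4p2 (R : realType) (T t r sigma S M : R) :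
  0 < T -> 0 <= t -> t < T -> 0 <= r -> 0 < sigma -> 0 < M -> M <= S ->
  let tau := T - t in
  let d1 := d1_ r sigma tau S M in
  let d2 := d2_ r sigma tau S M in
  let d3 := d3_ r sigma tau S M in
  let d4 := d4_ r sigma tau S M in
  let L := ln (S / M) in
  let B1 := Phi (- d1) in
  let B2 := expR (- (r * tau)) * Phi d2 in
  (* (i) r > 0 *)
  (0 < r ->
    let theta1 := 1 + sigma ^+ 2 / (2 * r) in
    let theta2 := 1 - sigma ^+ 2 / (2 * r) in
    let B3 := expR (- (r * tau)) * (S / M) `^ (- (2 * r / sigma ^+ 2)) * Phi d3 in
    let B4 := sigma * Num.sqrt tau * (S / M) `^ ((1 - 2 * r / sigma ^+ 2) / 2)
              * expR (- (d1 ^+ 2 + d4 ^+ 2) / 4) / Num.sqrt (2 * pi) in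
    let CBS := S - S * theta1 * B1 - M * B2 + S * (1 - theta2) * B3 in
    exists (C : R) (N : nat), forall n : nat, (N <= n)%N ->
      let kappa := kappa_ sigma tau S M n in
      let T1 := 12 * r / sigma ^+ 2 * theta2 * kappa
                - (1 + 4 * r ^+ 2 / sigma ^+ 4) * L in
      let T2 := 1 / 2 + kappa + d4 / (6 * sigma * Num.sqrt tau) * L in
      `| Cfl_n r sigma tau S M n
         - (CBS
            - S * (sigma * Num.sqrt tau / 2) * (theta1 * B1 + theta2 * B3)
                / Num.sqrt n%:R
            - (S * (sigma ^+ 2 * tau / 12)
                 * ((theta1 + 2) * B1 + (theta2 + 2 - T1) * B3)
               - M * T2 * B4) / n%:R) |
      <= C / (Num.sqrt n%:R) ^+ 3)
  /\
  (* (ii) r = 0 *)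
  (r = 0 ->
    let B3s := (L + sigma ^+ 2 * tau / 2) * Phi (- d1) in
    let B4s := sigma * Num.sqrt tau * expR (- (d1 ^+ 2) / 2) / Num.sqrt (2 * pi) in
    let CBS := S - S * B1 - M * B2 - S * (B3s - B4s) in
    exists (C : R) (N : nat), forall n : nat, (N <= n)%N ->
      let kappa := kappa_ sigma tau S M n in
      let T2s := 1 / 2 + kappa + sigma ^+ 2 * tau / 12
                 - d2 / (6 * sigma * Num.sqrt tau) * L in
      `| Cfl_n r sigma tau S M n
         - (CBS
            - S * (sigma * Num.sqrt tau / 2) * (2 * B1 + B3s - B4s)
                / Num.sqrt n%:R
            - (S * (sigma ^+ 2 * tau / 6)
                 * ((3 + 3 * kappa - sigma ^+ 2 * tau / 4) * B1 + B3s)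
               - S * T2s * B4s) / n%:R) |
      <= C / (Num.sqrt n%:R) ^+ 3).
Proof.
move=> T0 t0 tT r0 sigma0 M0 MS tau d1 d2 d3 d4 L B1 B2.
have tau0 : 0 < tau by rewrite subr_gt0.
have S0 : 0 < S by exact: lt_le_trans MS.
pose h := Num.sqrt tau; pose c := sigma * h; pose l := L / c.
have h0 : 0 < h by exact: sqrt_tau_gt0.
have c0 : 0 < c by rewrite mulr_gt0.
have l0 : 0 <= l by exact: log_moneyness_ge0.
have hE : tau = h ^+ 2 by exact: sqrt_tau_sqr.
have AE : expR (- (l * c)) = M / S by exact: discounted_ratio.
have B1E : B1 = Phi (drift0 c (- (r * tau)) - l) by rewrite /B1 /d1 d1E// opprK.
have d2E' : d2 = drift0 c (r * tau) + l by exact: d2E.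
have d3E' : d3 = drift0 c (r * tau) - l by exact: d3E.
have SN : S != 0 by rewrite gt_eqF.
have sN : sigma != 0 by rewrite gt_eqF.
have hN : h != 0 by rewrite gt_eqF.
split=> [r_gt0|req0].
  move=> theta1 theta2 B3 B4 CBS.
  have rN : r != 0 by rewrite gt_eqF.
  have x0 : 0 < r * tau by rewrite mulr_gt0.
  apply: (expands_Cfl tau0 sigma0 (expands_value_pos c0 l0 x0)) => n.
  have B3E' : B3 = expR (- (l * c)) * expR (- (r * tau))
      * expR (- (2 * l * drift0 c (r * tau))) * Phi (drift0 c (r * tau) - l).
    by rewrite /B3 B3E// d3E'.
  have B4E' : M * B4 = S * (sigma * h * phi (drift0 c (- (r * tau)) - l)) by exact: B4E.
  rewrite kappaE// -B3E' -B1E -d3E' AE -d2E'.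
  by apply: target_pos; rewrite ?rsqrt_sqr.
move=> B3s B4s CBS.
have x0 : r * tau = 0 by rewrite req0 mul0r.
apply: (expands_Cfl tau0 sigma0 (expands_value_zero c0 l0 x0)) => n.
have B4E' : B4s = sigma * h * phi (drift0 c (- (r * tau)) - l).
  by rewrite /B4s /d1 d1E// sqrrN /phi !mulrA.
rewrite kappaE// -B1E AE -d2E'.
by apply: target_zero; rewrite ?rsqrt_sqr.
Qed.
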